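(* Let $d\in\mathbb{N}$ and let $(X=G/\Gamma,T)$ be a minimal nilsystem, where $T$ is the translation $x\mapsto\tau x$ by an element $\tau\in G$, and assume that $G$ is spanned (as a group) by $G^0$ and $\tau$. For $x\in X$ and $g\in G_{d+1}$, if $x\neq gx$, then $(x,gx)$ is an $\mathrm{IN}^{[d]}$-pair.
   Context: $\mathbb{N}$ denotes the set of positive integers. A dynamical system $(X,T)$ is a compact metric space $X$ together with a homeomorphism $T:X\to X$. It is minimal if every point has dense orbit $\{T^nx:n\in\mathbb{Z}\}$. Nilsystem: $G$ is a nilpotent Lie group, $\Gamma$ a discrete cocompact subgroup, $X=G/\Gamma$ with $G$ acting by left translations $(g,x)\mapsto gx$, and $Tx=\tau x$ for some fixed $\tau\in G$. $G^0$ is the connected component of the unit element of $G$. The commutator subgroups are $G_1=G$, $G_{j+1}=[G_j,G]$, where $[A,B]$ is the subgroup spanned by the commutators $[a,b]=aba^{-1}b^{-1}$, $a\in A,b\in B$. For subsets $U_0,U_1\subset X$, a set $F\subset\mathbb{Z}$ is an independence set for $(U_0,U_1)$ if for every nonempty finite $J\subset F$ and every $s=(s(j):j\in J)\in\{0,1\}^J$ we have $\bigcap_{j\in J}T^{-j}U_{s(j)}\neq\emptyset$. A pair $(x_0,x_1)\in X\times X$ is an $\mathrm{IN}^{[d]}$-pair if for any $k\in\mathbb{N}$ and any neighborhoods $U_0,U_1$ of $x_0$ and $x_1$ respectively, there exist integers $p_j^{(i)}$, $1\leq i\leq k$, $1\leq j\leq d$, such that the set $\left(\bigcup_{i=1}^k\{p_1^{(i)}\epsilon(1)+\ldots+p_d^{(i)}\epsilon(d):\epsilon\in\{0,1\}^d\}\right)\setminus\{0\}$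 is an independence set for $(U_0,U_1)$. *)

(* Defs.v *)
From HB Require Import structures.
From mathcomp Require Import all_boot all_order all_algebra.
From mathcomp Require Import all_classical all_reals all_analysis.
Import GRing.Theory.
Import numFieldNormedType.Exports.

Set Implicit Arguments.
Unset Strict Implicit.
Unset Printing Implicit Defensive.

Local Open Scope classical_set_scope.
Local Open Scope quotient_scope.
Local Open Scope ring_scope.

(** * Smooth maps on open sets of normed spaces *)

(* [differentiable] is Fréchet differentiability at a point; [U] is meant to be
   open, so that the directional derivatives only depend on [f] on [U]. *)
Fixpoint Ck_on (R : realType) (V W : normedModType R) (k : nat)
    (U : set V) (f : V -> W) : Prop :=
  if k is k'.+1 then
    (forall x, U x -> differentiable f x) /\
    (forall v : V, Ck_on k' U (fun x => 'D_v f x))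
  else forall x, U x -> {for x, continuous f}.

Definition smooth_on (R : realType) (V W : normedModType R)
    (U : set V) (f : V -> W) : Prop := forall k, Ck_on k U f.

(** * Lie groups *)

(* [chart_map] and [chart_inv] are total functions, only relevant on
   [chart_dom] and on its (open) image respectively. *)
Record chart (R : realType) (M : topologicalType) (n : nat) := Chart {
  chart_dom : set M;
  chart_map : M -> 'rV[R]_n;
  chart_inv : 'rV[R]_n -> M;
  chart_dom_open : open chart_dom;
  chart_cod_open : open (chart_map @` chart_dom);
  chart_mapK : forall x, chart_dom x -> chart_inv (chart_map x) = x;
  chart_map_continuous : forall x, chart_dom x -> {for x, continuous chart_map};
  chart_inv_continuous : forall u, (chart_map @` chart_dom) u ->
    {for u, continuous chart_inv}
}.

Definition chart_cod (R : realType) (M : topologicalType) (n : nat)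
  (c : chart R M n) : set 'rV[R]_n := chart_map c @` chart_dom c.

Definition chart_compatible (R : realType) (M : topologicalType) (n : nat)
    (c c' : chart R M n) : Prop :=
  smooth_on (chart_cod c `&` chart_inv c @^-1` chart_dom c')
    (fun u => chart_map c' (chart_inv c u)).

HB.mixin Record isTopologicalGroup G of Group G & Topological G := {
  mulg_continuous : continuous (fun p : G * G => (p.1 * p.2)%g);
  invg_continuous : continuous (fun x : G => x^-1%g)
}.

#[short(type="topologicalGroupType")]
HB.structure Definition TopologicalGroup :=
  {G of Group G & Topological G & isTopologicalGroup G}.

(* The atlas need not be maximal.  Charts share one dimension, which may be 0:
   translations identify the components of a group. *)
HB.mixin Record isLieGroup (R : realType) G of TopologicalGroup G := {
  lie_dim : nat;
  lie_atlas : set (chart R G lie_dim);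
  lie_hausdorff : hausdorff_space G;
  lie_second_countable : @second_countable G;
  lie_atlas_cover : forall x : G, exists2 c, lie_atlas c & chart_dom c x;
  lie_atlas_compatible : forall c c',
    lie_atlas c -> lie_atlas c' -> chart_compatible c c';
  lie_mul_smooth : forall c1 c2 c3,
    lie_atlas c1 -> lie_atlas c2 -> lie_atlas c3 ->
    smooth_on
      [set p : 'rV[R]_lie_dim * 'rV[R]_lie_dim |
        [/\ chart_cod c1 p.1, chart_cod c2 p.2 &
            chart_dom c3 (chart_inv c1 p.1 * chart_inv c2 p.2)%g]]
      (fun p => chart_map c3 (chart_inv c1 p.1 * chart_inv c2 p.2)%g);
  lie_inv_smooth : forall c1 c2, lie_atlas c1 -> lie_atlas c2 ->
    smooth_on
      [set u : 'rV[R]_lie_dim |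
        chart_cod c1 u /\ chart_dom c2 ((chart_inv c1 u)^-1)%g]
      (fun u => chart_map c2 ((chart_inv c1 u)^-1)%g)
}.

#[short(type="lieGroupType")]
HB.structure Definition LieGroup (R : realType) :=
  {G of TopologicalGroup G & isLieGroup R G}.

(** * Commutator subgroups *)

Definition is_subgroup (G : groupType) (A : set G) : Prop :=
  [/\ A 1%g, forall x y, A x -> A y -> A (x * y)%g
    & forall x, A x -> A (x^-1)%g].

Definition generated (G : groupType) (A : set G) : set G :=
  smallest (@is_subgroup G) A.

(* MathComp's [~ a, b] is a^-1 * b^-1 * a * b, hence the explicit formula. *)
Definition commutator_subgroup (G : groupType) (A B : set G) : set G :=
  generated [set (a * b * a^-1 * b^-1)%g | a in A & b in B].

(* Indexed from 1: G_1 = G and G_{j+1} = [G_j, G] (the value at 0 is junk). *)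
Definition lower_central (G : groupType) (j : nat) : set G :=
  iter j.-1 (fun H => commutator_subgroup H [set: G]) [set: G].
Arguments lower_central : clear implicits.

Definition nilpotent_group (G : groupType) : Prop :=
  exists j, lower_central G j = [set 1%g].

Definition identity_component (G : topologicalGroupType) : set G :=
  connected_component [set: G] 1%g.
Arguments identity_component : clear implicits.

(** * The homogeneous space G / Gamma *)

Section CosetSpace.
Context (G : topologicalGroupType) (Gamma : groupClosed G).

Definition coset_rel : rel G := fun x y => (x^-1 * y)%g \in Gamma.

Lemma coset_rel_equiv : equiv_class_of coset_rel.
Proof.
split=> [x|x y|y x z]; rewrite /coset_rel.
- by rewrite mulVg gpred1.
- by apply/idP/idP => /gpredVr; rewrite invgM invgK.
- by move=> xy yz; have := gpredM _ _ xy yz; rewrite mulgA mulgK.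
Qed.

Canonical coset_equiv := EquivRelPack coset_rel_equiv.

Definition coset_space : Type := quotient_topology {eq_quot coset_equiv}.

Definition translate (g : G) (x : coset_space) : coset_space :=
  \pi_coset_space (g * repr x)%g.

Lemma translate_pi (g h : G) :
  translate g (\pi_coset_space h) = \pi_coset_space (g * h)%g.
Proof.
have /eqmodP h_repr := reprK (\pi_coset_space h).
apply/eqmodP; rewrite /= /coset_rel invgM -mulgA mulKg.
exact: h_repr.
Qed.

Lemma translateK (g h : G) : (g * h)%g = 1%g ->
  cancel (translate h) (translate g).
Proof.
by move=> gh x; rewrite [translate h x]/translate translate_pi mulgA gh mul1g reprK.
Qed.

Lemma translate_continuous (g : G) : continuous (translate g).
Proof.
apply/quotient_continuous.
have -> : translate g \o \pi_coset_space =
          \pi_coset_space \o (fun h : G => (g * h)%g).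
  by apply/funext => h /=; rewrite translate_pi.
move=> h; apply: continuous_comp; last exact: pi_continuous.
apply: (@cvg_comp _ _ _ (fun h : G => (g, h)) (fun p : G * G => (p.1 * p.2)%g)
          _ (nbhs (g, h))).
  by apply: cvg_pair; [exact: cvg_cst | exact: cvg_id].
exact: (@mulg_continuous G (g, h)).
Qed.

End CosetSpace.

(** * Dynamical systems *)

Record homeo (X : topologicalType) := Homeo {
  homeo_fun :> X -> X;
  homeo_inv : X -> X;
  homeo_funK : cancel homeo_fun homeo_inv;
  homeo_invK : cancel homeo_inv homeo_fun;
  homeo_continuous : continuous homeo_fun;
  homeo_inv_continuous : continuous homeo_inv
}.

(* T^n for n : int; [Negz m] is - m.+1. *)
Definition iterz (X : topologicalType) (T : homeo X) (n : int) : X -> X :=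
  match n with
  | Posz m => iter m T
  | Negz m => iter m.+1 (homeo_inv T)
  end.

Definition minimal (X : topologicalType) (T : homeo X) : Prop :=
  forall x : X, dense (range (fun n : int => iterz T n x)).

Definition translation (G : topologicalGroupType) (Gamma : groupClosed G)
    (tau : G) : homeo (coset_space Gamma) :=
  Homeo (translateK (mulVg tau)) (translateK (mulgV tau))
    (@translate_continuous _ Gamma tau)
    (@translate_continuous _ Gamma tau^-1%g).

Definition independence_set (X : topologicalType) (T : homeo X)
    (U0 U1 : set X) (F : set int) : Prop :=
  forall (J : set int) (s : int -> bool),
    finite_set J -> J !=set0 -> J `<=` F ->
    \bigcap_(j in J) (iterz T j @^-1` (if s j then U1 else U0)) !=set0.

Definition cube_sum (d : nat) (p : 'I_d -> int) (e : {ffun 'I_d -> bool}) : int :=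
  \sum_(j < d) p j *+ e j.

Definition cubes (k d : nat) (p : 'I_k -> 'I_d -> int) : set int :=
  [set n | exists i e, n = cube_sum (p i) e].

(* The k * (2 ^ d - 1) sums with e <> 0 are nonzero and pairwise distinct. *)
Definition nondegenerate_cubes (k d : nat) (p : 'I_k -> 'I_d -> int) : Prop :=
  (forall i (e : {ffun 'I_d -> bool}), e != [ffun=> false] ->
     cube_sum (p i) e <> 0) /\
  (forall i i' (e e' : {ffun 'I_d -> bool}),
     e != [ffun=> false] -> e' != [ffun=> false] ->
     cube_sum (p i) e = cube_sum (p i') e' -> i = i' /\ e = e').

(* Without [nondegenerate_cubes] the notion would be void: for p = 0 the set below is
   empty, and the empty set is an independence set for any (U0, U1). *)
Definition IN_pair (X : topologicalType) (T : homeo X) (d : nat)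
    (x0 x1 : X) : Prop :=
  forall (k : nat) (U0 U1 : set X),
    (0 < k)%N -> nbhs x0 U0 -> nbhs x1 U1 ->
    exists2 p : 'I_k -> 'I_d -> int,
      nondegenerate_cubes p & independence_set T U0 U1 (cubes p `\ 0).

(* Main.v *)
Require Import Defs.
From HB Require Import structures.
From Corelib Require Setoid Morphisms RelationClasses.
From mathcomp Require Import all_boot all_order all_algebra.
From mathcomp Require Import all_classical all_reals all_analysis.
From mathcomp Require Import lra.

Set Implicit Arguments.
Unset Strict Implicit.
Unset Printing Implicit Defensive.

Import Order.TTheory GRing.Theory Num.Theory.
Import numFieldNormedType.Exports.

Local Open Scope classical_set_scope.
Local Open Scope group_scope.

(** Right multiplications commute with the action of [tau], so the theorem is restated
    with factors on the right: writing [x] as the coset of [a] and [g * a] as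
    [a * g'], it suffices to find times for which a point close to [a] can be sent close
    to [a] or to [a * g'], independently at each vertex of the cubes.  One considers
    finitely many points [a l] at once, one for each pattern of zeros and ones: since a
    perturbation may be chosen separately for every [l], but the cube of times is common,
    all patterns are obtained simultaneously.  The [k] cubes are then found one after the
    other ([realize_cubes]), each by perturbing the points so little that the earlier
    conditions are not destroyed.  The cubes are nondegenerate because [x] and
    [translate g x] have disjoint neighborhoods: two vertices at which the prescribed
    sides differ cannot be the same time.

    The heart is [realizable_patterns]: on a cube with [i] directions every pattern
    with values in [G_j], [j > i], can be realized for any finite family of
    points.  The induction is upwards on [i] and downwards on [j].  Realizations can be
    composed, by adding the times, and everything in [G_{j+1}] may be corrected
    afterwards, so one may compute modulo [G_{j+1}], where [G_j] is central, and treat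
    a single vertex and a single point.  The elements that can occur there form a
    closed subgroup [S] of [G_j], which contains the elements of [Gamma] in [G_j], as
    these move nothing.

    New elements come from commutators.  Let [n] be a large time at which all points
    return ([recurrent_all]), and take it as the last direction.  If the smaller cube
    perturbs the points by a very small [k] in [G_{j-1}], then after time [n] the
    perturbation has become a commutator of [k] and [tau ^+ n], that is [k ^+ n]
    and [tau], which has a definite size when [k] is an [n]-th root of a fixed element
    ([single_comm]).  Small roots are a property of Lie groups: near the unit the group
    law is addition up to a small error, so approximate [n]-th roots exist
    and the error is removed by iteration ([near_infinitely_divisible]).  It suffices to
    take roots modulo commutators.

    This gives the commutators of depth [j] ending in [tau].  All others follow
    ([filling]) since iterated commutators are multilinear modulo [G_{j+1}] and since
    [tau ^+ n * c], with [c] in [Gamma], is dense: letters are replaced one after the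
    other, from [Gamma] to [tau] and hence to all of [G].  A letter [tau] inside a
    commutator is handled by trading an [n]-th root of the outermost letter for
    the power [tau ^+ n], which for return times is close to [Gamma].  The group [G] is
    generated by [tau] and its unit component, hence by [tau] and elements with
    small roots. *)

(** * The lower central series *)

(* An identity of free groups holds because both sides have the same reduced word. *)
Ltac word := rewrite ?(invgM, invgK, invg1, mulgA, mul1g, mulg1, mulgV, mulVg,
  mulgK, mulgVK).

Section LowerCentral.
Context (G : groupType).
Implicit Types (x y z b c : G) (i j n : nat) (H : set G).

Local Notation L := (lower_central G).

Definition comm x y := x * y * x^-1 * y^-1.

Lemma generated_subgroup (A : set G) : is_subgroup (generated A).
Proof.
split=> [H [[] //]|x y Ax Ay H [subH AH]|x Ax H [subH AH]].
  by case: (subH) => _ HM _; apply: HM; [apply: Ax | apply: Ay].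
by case: (subH) => _ _; apply; apply: Ax.
Qed.

Lemma generated_sub (A H : set G) :
  is_subgroup H -> A `<=` H -> generated A `<=` H.
Proof. by move=> subH AH x; apply. Qed.

Lemma generated_incl (A : set G) : A `<=` generated A.
Proof. by move=> x Ax H [_]; apply. Qed.

Lemma lcs_subgroup j : is_subgroup (L j).
Proof. by case: j => [|[|j]]; [split|split|exact: generated_subgroup]. Qed.

Lemma lcs1 j : L j 1. Proof. by case: (lcs_subgroup j). Qed.
Lemma lcsM j x y : L j x -> L j y -> L j (x * y).
Proof. by case: (lcs_subgroup j) => _ + _; apply. Qed.
Lemma lcsV j x : L j x -> L j x^-1.
Proof. by case: (lcs_subgroup j) => _ _; apply. Qed.

Lemma lcs_comm j x y : L j x -> L j.+1 (comm x y).
Proof.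
case: j => [|j] // Lx; apply: generated_incl.
by exists x => //; exists y.
Qed.

Lemma lcs_gen j H : is_subgroup H ->
  (forall x y, L j.+1 x -> H (comm x y)) -> L j.+2 `<=` H.
Proof.
move=> subH Hc; apply: generated_sub => // _ [x Lx] [y _] <-.
exact: Hc.
Qed.

Lemma lcsJ j x y : L j x -> L j (y * x * y^-1).
Proof.
elim: j x y => [|[|j] IHj] // x y Lx.
pose H := [set z | forall y, L j.+2 (y * z * y^-1)].
suff /(_ x Lx y) : L j.+2 `<=` H by [].
apply: lcs_gen => [|a b La w].
  split=> [w|a b Ha Hb w|a Ha w].
  - by rewrite /= mulg1 mulgV; exact: lcs1.
  - rewrite [X in L _ X](_ : _ = (w * a * w^-1) * (w * b * w^-1)); last by word.
    by apply: lcsM; [exact: Ha|exact: Hb].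
  - rewrite [X in L _ X](_ : _ = (w * a * w^-1)^-1); last by word.
    by apply: lcsV; exact: Ha.
rewrite [X in L _ X](_ : _ = comm (w * a * w^-1) (w * b * w^-1)).
  exact/lcs_comm/IHj.
by rewrite /comm; word.
Qed.

Lemma lcsS j : L j.+1 `<=` L j.
Proof.
case: j => [|j] // x; apply: (@lcs_gen j) => [|a b La].
  exact: lcs_subgroup.
rewrite (_ : comm a b = a * (b * a^-1 * b^-1)); last by rewrite /comm; word.
by apply: lcsM => //; apply: lcsJ; exact: lcsV.
Qed.

Lemma lcs_le i j : (i <= j)%N -> L j `<=` L i.
Proof.
move=> /subnK <-; elim: (j - i)%N => [|k IHk] x // /lcsS; exact: IHk.
Qed.

(** ** Congruence modulo a term of the lower central series *)

Definition cong j x y := L j (x^-1 * y).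

Local Notation "x =[ j ] y" := (cong j x y)
  (at level 70, j at level 0, format "x  =[ j ]  y").

Global Instance cong_equiv j : RelationClasses.Equivalence (cong j).
Proof.
rewrite /cong; split=> [x|x y xy|x y z xy yz].
- by rewrite mulVg; exact: lcs1.
- by rewrite [X in L _ X](_ : _ = (x^-1 * y)^-1); [exact: lcsV|word].
- by rewrite [X in L _ X](_ : _ = (x^-1 * y) * (y^-1 * z)); [exact: lcsM|word].
Qed.

Global Instance mulg_cong j :
  Morphisms.Proper
    (Morphisms.respectful (cong j) (Morphisms.respectful (cong j) (cong j)))
    (fun x y => x * y).
Proof.
rewrite /cong => x x' xx' y y' yy'.
rewrite [X in L _ X](_ : _ = (y^-1 * (x^-1 * x') * y^-1^-1) * (y^-1 * y')); last by word.
by apply: lcsM => //; exact: lcsJ.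
Qed.

Global Instance invg_cong j :
  Morphisms.Proper (Morphisms.respectful (cong j) (cong j)) (fun x => x^-1).
Proof.
rewrite /cong => x y /(@lcsV j) xy.
rewrite [X in L _ X](_ : _ = (x * (x^-1 * y)^-1 * x^-1)); last by word.
exact: lcsJ.
Qed.

Lemma cong_refl j x : x =[j] x. Proof. reflexivity. Qed.
Hint Resolve cong_refl : core.

Lemma cong_sym j x y : x =[j] y -> y =[j] x. Proof. by move=> xy; symmetry. Qed.

Lemma cong_le i j x y : (i <= j)%N -> x =[j] y -> x =[i] y.
Proof. by move=> ij; exact: (lcs_le ij). Qed.

Lemma cong1P j x : x =[j] 1 <-> L j x.
Proof.
rewrite /cong mulg1; split=> [/lcsV|]; last exact: lcsV.
by rewrite invgK.
Qed.

Lemma lcs_cong i j x y : (i <= j)%N -> x =[j] y -> L i x -> L i y.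
Proof.
by move=> ij /(cong_le ij) xy Lx; rewrite -(mulVKg x y); exact: lcsM.
Qed.

Lemma congMr j x c : L j c -> x * c =[j] x.
Proof. by move=> Lc; rewrite /cong invgM mulgVK; exact: lcsV. Qed.

Lemma cong_central j x z : L j z -> x * z =[j.+1] z * x.
Proof.
move=> Lz; rewrite /cong [X in L _ X](_ : _ = comm z^-1 x^-1).
  by apply: lcs_comm; exact: lcsV.
by rewrite /comm; word.
Qed.

Lemma commMl j x y b : L j x -> L j y ->
  comm (x * y) b =[j.+2] comm x b * comm y b.
Proof.
move=> Lx Ly; rewrite (_ : comm (x * y) b = x * comm y b * x^-1 * comm x b);
  last by rewrite /comm; word.
rewrite (cong_central x (lcs_comm b Ly)) mulgK.
by rewrite (cong_central (comm y b) (lcs_comm b Lx)).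
Qed.

Lemma commMr j x b c : L j x -> comm x (b * c) =[j.+2] comm x b * comm x c.
Proof.
move=> Lx; rewrite (_ : comm x (b * c) = comm x b * (b * comm x c * b^-1));
  last by rewrite /comm; word.
by rewrite (cong_central b (lcs_comm c Lx)) mulgK.
Qed.

Lemma comm1l b : comm 1 b = 1. Proof. by rewrite /comm; word. Qed.
Lemma comm1r b : comm b 1 = 1. Proof. by rewrite /comm; word. Qed.

Lemma comm_cong j x y b : x =[j.+1] y -> comm x b =[j.+2] comm y b.
Proof.
move=> xy; rewrite -[in X in _ =[_] X](mulVKg x y); set c := x^-1 * y.
have Lc : L j.+1 c := xy.
rewrite (_ : comm (x * c) b = x * comm c b * x^-1 * comm x b);
  last by rewrite /comm; word.
rewrite (cong_central x (lcsS (lcs_comm b Lc))) mulgK.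
by rewrite /cong; word; rewrite -mulgA; have := lcsJ (comm x b)^-1 (lcs_comm b Lc); word.
Qed.

(** ** Iterated commutators *)

Definition comms x (s : seq G) := foldl comm x s.

Lemma comms_rcons x s b : comms x (rcons s b) = comm (comms x s) b.
Proof. by rewrite /comms -cats1 foldl_cat. Qed.

Lemma comms1 s : comms 1 s = 1.
Proof. by elim: s => //= b s IHs; rewrite comm1l. Qed.

Lemma lcs_comms i x s : L i x -> L (i + size s) (comms x s).
Proof.
elim: s i x => [|b s IHs] i x Lx /=; first by rewrite addn0.
by rewrite addnS -addSn; apply/IHs/lcs_comm.
Qed.

Lemma subgroup_cong j H x y : is_subgroup H -> L j `<=` H ->
  x =[j] y -> H x -> H y.
Proof.
by case=> _ HM _ LH xy Hx; rewrite -(mulVKg x y); apply: HM => //; exact: LH.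
Qed.

(** Commutators are bilinear modulo the next term of the series, so commutators of
    products reduce to products of commutators. *)
Lemma comms_gen j H : is_subgroup H -> L j.+2 `<=` H ->
  (forall x s, size s = j -> H (comms x s)) -> L j.+1 `<=` H.
Proof.
elim: j H => [|j IHj] H subH LH Hc; first by move=> x _; exact: (Hc x [::]).
have [H1 HM HV] := subH.
pose K := [set x | L j.+1 x /\ forall b, H (comm x b)].
apply: lcs_gen => // x b Lx; suff [] : K x by [].
apply: IHj Lx => [|y Ly|y s sj].
- split=> [|y z [Ly Ky] [Lz Kz]|y [Ly Ky]].
  + by split=> [|c]; [exact: lcs1|rewrite comm1l].
  + split=> [|c]; first exact: lcsM.
    apply: (subgroup_cong subH LH _ (HM _ _ (Ky c) (Kz c))).
    by symmetry; exact: commMl.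
  + split=> [|c]; first exact: lcsV.
    apply: (subgroup_cong subH LH _ (HV _ (Ky c))).
    have := commMl c Ly (lcsV Ly); rewrite mulgV comm1l => yc.
    by rewrite -[(comm y c)^-1]mulg1 yc mulKg.
- by split=> [|c]; [exact: lcsS|exact/LH/lcs_comm].
- split=> [|c]; first by rewrite -sj -add1n; exact: lcs_comms.
  by rewrite -comms_rcons; apply: Hc; rewrite size_rcons sj.
Qed.

End LowerCentral.

#[global] Hint Resolve cong_refl : core.

Notation "x =[ j ] y" := (cong j x y)
  (at level 70, j at level 0, format "x  =[ j ]  y").

(** * Neighborhoods of the unit *)

Section Continuity.
Context (G : topologicalGroupType).

Lemma mulg_cont (T : topologicalType) (f g : T -> G) :
  continuous f -> continuous g -> continuous (fun t => f t * g t).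
Proof.
move=> cf cg t; apply: (@cvg_comp _ _ _ (fun t => (f t, g t))
  (fun p : G * G => p.1 * p.2) _ (nbhs (f t, g t))); last exact: (@mulg_continuous G (f t, g t)).
by apply: cvg_pair; [exact: cf|exact: cg].
Qed.

Lemma invg_cont (T : topologicalType) (f : T -> G) :
  continuous f -> continuous (fun t => (f t)^-1).
Proof. by move=> cf t; apply: continuous_comp (cf t) _; exact: invg_continuous. Qed.

Lemma idg_cont : continuous (fun x : G => x).
Proof. by move=> x. Qed.

Lemma cstg_cont (T : topologicalType) (a : G) : continuous (fun _ : T => a).
Proof. exact: cst_continuous. Qed.

End Continuity.

Ltac contg := rewrite ?/comm; repeat first
  [exact: idg_cont | exact: cstg_cont | apply: mulg_cont | apply: invg_cont].

Section Neighborhoods.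
Context (G : topologicalGroupType).
Implicit Types (g : G) (U V : set G).

Lemma nbhs_word (f : G -> G) U :
  continuous f -> nbhs (f 1) U -> \forall u \near 1, U (f u).
Proof. by move=> cf; exact: (cf 1 U). Qed.

Lemma nbhs1_conj U g : nbhs 1 U -> \forall u \near 1, U (g * u * g^-1).
Proof.
move=> U1; apply: (nbhs_word (f := fun u => g * u * g^-1)); first by contg.
by rewrite mulg1 mulgV.
Qed.

Lemma nbhs1_mul U : nbhs 1 U ->
  exists2 V, nbhs 1 V & forall u v, V u -> V v -> U (u * v).
Proof.
move=> U1; have := @mulg_continuous G (1, 1) U; rewrite /= mulg1 => /(_ U1).
move=> [[A B] /= [A1 B1] AB]; exists (A `&` B); first exact: filterI.
by move=> u v [Au _] [_ Bv]; exact: (AB (u, v)).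
Qed.

Lemma nbhs1_inv U : nbhs 1 U -> \forall u \near 1, U u^-1.
Proof. by move=> U1; apply: (nbhs_word (f := fun u => u^-1)); [contg|rewrite invg1]. Qed.

Lemma nbhs_mul1 U g : nbhs g U -> \forall u \near 1, U (g * u).
Proof. by move=> Ug; apply: (nbhs_word (f := fun u => g * u)); [contg|rewrite mulg1]. Qed.

Lemma nbhs_mul1K U g : (\forall u \near 1, U (g * u)) -> nbhs g U.
Proof.
move=> Ug; have c : continuous (fun x : G => g^-1 * x) by contg.
have := c g (fun u => U (g * u)); rewrite /= mulVg => /(_ Ug) H.
apply: (@filterS _ (nbhs g) _ _ _ _ H) => x /=.
by rewrite mulVKg.
Qed.

End Neighborhoods.

(** * Graded homomorphisms *)

Section GradedHom.
Context (G : topologicalGroupType).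
Implicit Types (x y z b c : G) (i j n : nat) (U V W : set G).

Local Notation L := (lower_central G).

(** These are the maps whose behaviour modulo [L i.+1] is that of a homomorphism
    to the abelian group [L i / L i.+1]. *)
Record grhom i (f : G -> G) : Prop := GrHom {
  grhom_in : forall x, L i (f x);
  grhomM : forall x y, f (x * y) =[i.+1] f x * f y;
  grhom1 : f 1 = 1;
  grhom_cont : continuous f }.

Lemma grhomX i f x n : grhom i f -> f (x ^+ n) =[i.+1] f x ^+ n.
Proof.
move=> gf; elim: n => [|n IHn]; first by rewrite !expg0 (grhom1 gf).
by rewrite !expgS (grhomM gf) IHn.
Qed.

Lemma grhomV i f x : grhom i f -> f x^-1 =[i.+1] (f x)^-1.
Proof.
move=> gf; have := grhomM gf x x^-1; rewrite mulgV (grhom1 gf) => e.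
by rewrite -[(f x)^-1]mulg1 e mulKg.
Qed.

Lemma grhom_id : grhom 1 id.
Proof. by split=> //; exact: idg_cont. Qed.

Lemma grhom_comm i f b : grhom i f -> grhom i.+1 (fun x => comm (f x) b).
Proof.
move=> gf; split=> [x|x y||].
- exact/lcs_comm/(grhom_in gf).
- rewrite (comm_cong b (grhomM gf x y)).
  by apply: commMl; exact: (grhom_in gf).
- by rewrite (grhom1 gf) comm1l.
- by have := grhom_cont gf => cf; rewrite /comm; repeat first
    [exact: cf | exact: cstg_cont | apply: mulg_cont | apply: invg_cont].
Qed.

Lemma grhom_commr i z : L i z -> grhom i.+1 (fun x => comm z x).
Proof.
move=> Lz; split=> [x|x y||].
- exact: lcs_comm.
- exact: commMr.
- exact: comm1r.
- by contg.
Qed.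

Lemma grhom_comms i f s : grhom i f -> grhom (i + size s) (fun x => comms (f x) s).
Proof.
elim: s i f => [|b s IHs] i f gf; first by rewrite addn0.
by rewrite addnS -addSn; apply: (IHs _ (fun x => comm (f x) b)); exact: grhom_comm.
Qed.

(** By bilinearity both sides are congruent to [comm (f x) y ^+ n]. *)
Lemma comm_expg i f x y n : grhom i f ->
  comm (f x) (y ^+ n) =[i.+2] comm (f (x ^+ n)) y.
Proof.
move=> gf; rewrite (grhomX y n (grhom_commr (grhom_in gf x))).
by symmetry; apply: (grhomX x n (grhom_comm y gf)).
Qed.

Lemma grhom_lcs2 i f c : grhom i f -> L 2 c -> L i.+1 (f c).
Proof.
move=> gf; pose H := [set x | L i.+1 (f x)].
have HV x : H x -> H x^-1.
  move=> Hx; apply: (@lcs_cong _ i.+1 i.+1 _ _ (leqnn _)); last exact: (lcsV Hx).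
  by symmetry; exact: grhomV.
have HM x y : H x -> H y -> H (x * y).
  move=> Hx Hy; apply: (@lcs_cong _ i.+1 i.+1 _ _ (leqnn _)); last exact: (lcsM Hx Hy).
  by symmetry; exact: grhomM.
apply: (@lcs_gen _ 0 H) => [|x y _]; first by split=> //; rewrite /H/= (grhom1 gf); exact: lcs1.
apply: (@lcs_cong _ i.+1 i.+1 _ _ (leqnn _)); last exact: (lcs_comm (f y) (grhom_in gf x)).
by symmetry; rewrite /comm !(grhomM gf) !(grhomV _ gf).
Qed.

Lemma grhom_cong2 i f x y : grhom i f -> x =[2] y -> f x =[i.+1] f y.
Proof.
move=> gf xy; rewrite -(mulVKg x y) (grhomM gf).
by symmetry; apply: congMr; exact: grhom_lcs2.
Qed.

(** ** Elements with small roots *)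

(** Graded homomorphisms ignore commutators, so roots modulo commutators suffice; with
    this weakening, products and inverses of such elements are again of this kind. *)
Definition infinitely_divisible (h : G) := forall U, nbhs 1 U ->
  exists N, forall n, (N <= n)%N ->
  exists k u, [/\ U k, U u & k ^+ n =[2] h * u].

Lemma cong2_mulC x y : x * y =[2] y * x.
Proof. exact: (@cong_central G 1). Qed.

Lemma expgMn_cong2 x y n : (x * y) ^+ n =[2] x ^+ n * y ^+ n.
Proof.
elim: n => [|n IHn]; first by rewrite !expg0 mulg1.
rewrite !expgS IHn !mulgA -(mulgA x) (cong2_mulC y) mulgA.
reflexivity.
Qed.

Lemma infinitely_divisible_subgroup : is_subgroup infinitely_divisible.
Proof.
split=> [U U1|x y dx dy U /nbhs1_mul[V V1 VU]|x dx U U1].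
- exists 0 => n _; exists 1, 1; rewrite expg1n mulg1.
  by split=> //; exact: nbhs_singleton.
- have [N1 HN1] := dx _ V1; have [N2 HN2] := dy _ V1.
  exists (maxn N1 N2) => n; rewrite geq_max => /andP[/HN1 + /HN2].
  move=> [k [u [Vk Vu e]]] [k' [u' [Vk' Vu' e']]].
  exists (k * k'), (u * u'); split; [exact: VU|exact: VU|].
  rewrite expgMn_cong2 e e' !mulgA -[x * u * y]mulgA (cong2_mulC u) !mulgA.
  reflexivity.
- have [N HN] := dx _ (nbhs1_inv U1).
  exists N => n /HN[k [u [Uk Uu e]]]; exists k^-1, u^-1; split => //.
  by rewrite expVgn e invgM cong2_mulC.
Qed.

End GradedHom.

(** * Simultaneous recurrence *)

Section Recurrence.
Context (G : topologicalGroupType) (Gamma : set G) (tau : G).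
Hypothesis Gamma_subgroup : is_subgroup Gamma.
Hypothesis cocompact : forall U, nbhs 1 U -> exists s : seq G,
  forall x, exists b u c, [/\ b \in s, U u, Gamma c & x = u * b * c].

Local Notation L := (lower_central G).

Let Gamma1 : Gamma 1. Proof. by case: Gamma_subgroup. Qed.
Let GammaM x y : Gamma x -> Gamma y -> Gamma (x * y).
Proof. by case: Gamma_subgroup => _ + _; apply. Qed.
Let GammaV x : Gamma x -> Gamma x^-1.
Proof. by case: Gamma_subgroup => _ _; apply. Qed.

(** Recurrence of a point of a power of [G / Gamma].  The congruence is what allows an
    induction along the lower central series. *)
Definition recurrent (M : finType) j := forall (a : M -> G) U N, nbhs 1 U ->
  exists2 n, (N <= n)%N & forall l, exists c u,
    [/\ Gamma c, U u & tau ^+ n * a l * c =[j] a l * u].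

(** With partial sums [m] and partial products [C], every pair [i < i'] yields a
    return time [m i' - m i], whose displacement in [L j] is that of the
    interval between [i] and [i']. *)
Definition chain (M : finType) j (a : M -> G) (U : set G) N t (m : nat -> nat)
    (C : nat -> M -> G) :=
  (forall i l, (i <= t)%N -> L j (C i l)) /\
  forall i i', (i < i' <= t)%N -> (m i + N <= m i')%N /\
    forall l, exists c u, [/\ Gamma c, U u &
      tau ^+ (m i' - m i) * a l * c =[j.+1] a l * u * (C i l)^-1 * C i' l].

(** The next return time is chosen last and finest: its error is conjugated by the
    elements of [Gamma] that belong to the earlier times. *)
Lemma chain_exists (M : finType) j (a : M -> G) U N t :
  recurrent M j -> open U -> U 1 -> exists m C, chain j a U N t m C.
Proof.
move=> rec oU U1; elim: t => [|t [m [C [LC mC]]]].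
  exists (fun=> 0%N), (fun _ _ => 1); split=> [*|i i' /andP[]]; first exact: lcs1.
  by rewrite leqn0 => /[swap] /eqP ->.
have near_u : \forall u' \near 1, forall (i : 'I_t) (l : M), exists c u,
    [/\ Gamma c, tau ^+ (m t - m i) * a l * c =[j.+1] a l * u * (C i l)^-1 * C t l
      & U (u * c^-1 * u' * c)].
  apply: filter_forall => i; apply: filter_forall => l.
  have /mC[_ /(_ l)[c [u [Gc Uu e]]]] : (i < t <= t)%N by rewrite ltn_ord leqnn.
  have : \forall u' \near 1, U (u * c^-1 * u' * c).
    apply: (nbhs_word (f := fun u' => u * c^-1 * u' * c)); first by contg.
    by word; apply: open_nbhs_nbhs.
  by apply: filterS => u' Uu'; exists c, u.
have [n nN Hn] := rec a _ N (filterI near_u (open_nbhs_nbhs (conj oU U1))).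
have {Hn}/choice[c' Hc'] : forall l, exists cu : G * G, [/\ Gamma cu.1,
    forall i : 'I_t, exists c u,
    [/\ Gamma c, tau ^+ (m t - m i) * a l * c =[j.+1] a l * u * (C i l)^-1 * C t l
      & U (u * c^-1 * cu.2 * c)], U cu.2 & tau ^+ n * a l * cu.1 =[j] a l * cu.2].
  move=> l; have [c [u [Gc [Hu Uu] e]]] := Hn l.
  by exists (c, u); split=> // i; exact: (Hu i l).
pose d l := (c' l).2^-1 * (a l)^-1 * tau ^+ n * a l * (c' l).1.
have Ld l : L j (d l).
  by have [_ _ _] := Hc' l; move/cong_sym; rewrite /cong /d; word.
pose m' i := if (i <= t)%N then m i else (m t + n)%N.
pose C' i l := if (i <= t)%N then C i l else C t l * d l.
exists m', C'; split=> [i l _|i i' /andP[ii']].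
  by rewrite /C'; case: leqP => it; [exact: LC|apply: lcsM => //; exact: LC].
rewrite leq_eqVlt => /predU1P[i't|]; last first.
  rewrite ltnS => i't; rewrite /m' /C' i't (leq_trans (ltnW ii') i't).
  by apply: mC; rewrite ii'.
have it : (i <= t)%N by rewrite -ltnS -i't.
rewrite /m' /C' it i't ltnn; split.
  case: (ltngtP i t) it => // [it _|-> _]; last by rewrite leq_add2l.
  have /mC[imt _] : (i < t <= t)%N by rewrite it /=.
  by rewrite (leq_trans imt) // leq_addr.
move=> l; have [Gc Hi Uu _] := Hc' l.
have e : tau ^+ n * a l = a l * (c' l).2 * d l * (c' l).1^-1 by rewrite /d; word.
case: (ltngtP i t) it => // [it _|-> _]; last first.
  exists (c' l).1, (c' l).2; split => //.
  by rewrite addKn e; word.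
have [c [u [Gcc eq Uuc]]] := Hi (Ordinal it).
exists ((c' l).1 * c), (u * c^-1 * (c' l).2 * c); split; [exact: GammaM|by []|].
have /mC[imt _] : (i < t <= t)%N by rewrite it /=.
have mit : (m i <= m t)%N by rewrite (leq_trans _ imt) // leq_addr.
have -> : (m t + n - m i = (m t - m i) + n)%N by rewrite addnBAC.
rewrite expgnDr -(mulgA (tau ^+ _)) e.
have -> : tau ^+ (m t - m i) * (a l * (c' l).2 * d l * (c' l).1^-1) * ((c' l).1 * c)
   = (tau ^+ (m t - m i) * a l * c) * c^-1 * (c' l).2 * d l * c by word.
rewrite eq /=; set f := C i l; set g := C t l.
have Lf : L j f^-1 by apply/lcsV/LC/ltnW.
have Lg : L j g by exact: LC.
rewrite -(mulgA _ (d l) c) -(cong_central c (Ld l)).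
have -> : a l * u * f^-1 * g * c^-1 * (c' l).2 * (c * d l) =
  a l * u * (f^-1 * g) * (c^-1 * (c' l).2 * c) * d l by word.
rewrite -(mulgA (a l * u) (f^-1 * g)) -(cong_central _ (lcsM Lf Lg)).
by word.
Qed.

(** By the pigeonhole principle two of the points reached along a long chain
    agree approximately, so the displacement between them is close to an
    element of [Gamma]. *)
Lemma recurrentS (M : finType) j : recurrent M j -> recurrent M j.+1.
Proof.
move=> rec a U N /nbhs1_mul[V V1 VU].
have [W W1 WV] : exists2 W, nbhs 1 W & forall l v w, W v -> W w ->
    V ((a l)^-1 * (v * w^-1) * a l).
  have : \forall u \near 1, forall l, V ((a l)^-1 * u * a l).
    by apply: filter_forall => l; have := nbhs1_conj (a l)^-1 V1; rewrite invgK.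
  move=> /nbhs1_mul[W W1 HW].
  exists (fun w => W w /\ W w^-1); first exact: filterI W1 (nbhs1_inv W1).
  by move=> l v w [Wv _] [_ Ww]; exact: HW.
have [s Hs] := cocompact W1.
pose t := #|{ffun M -> 'I_(size s).+1}|.
have oV : open V^° by exact: open_interior.
have [m [C [LC mC]]] := @chain_exists M j a _ N t rec oV (nbhs_singleton (nbhs_interior V1)).
have /choice[p Hp] : forall il : nat * M, exists p : G * G * G,
    [/\ p.1.1 \in s, W p.1.2, Gamma p.2 & a il.2 * C il.1 il.2 = p.1.2 * p.1.1 * p.2].
  move=> il; have [b [u [c [? ? ? ?]]]] := Hs (a il.2 * C il.1 il.2).
  by exists (b, u, c).
pose q (i : 'I_t.+1) := [ffun l => inord (index (p (nat_of_ord i, l)).1.1 s) : 'I_(size s).+1].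
have /injectivePn[i [i' ii' qq]] : ~~ injectiveb q.
  apply/negP => /injectiveP/leq_card; rewrite card_ord; apply/negP.
  by rewrite -ltnNge.
wlog lt_ii' : i i' ii' qq / (i < i')%N.
  move=> H; case: (ltngtP i i') => [||e]; first exact: H.
    by apply: H; rewrite // eq_sym.
  by move: ii'; rewrite (val_inj e) eqxx.
have /mC[mN Hl] : (i < i' <= t)%N by rewrite lt_ii' -ltnS ltn_ord.
exists (m i' - m i)%N; first by rewrite leq_subRL // (leq_trans _ mN) // leq_addr.
move=> l; have [c [u [Gc Vu e]]] := Hl l.
have [/= si Wi Gi ei] := Hp (nat_of_ord i, l).
have [/= si' Wi' Gi' ei'] := Hp (nat_of_ord i', l).
have bb : (p (nat_of_ord i, l)).1.1 = (p (nat_of_ord i', l)).1.1.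
  move/ffunP: qq => /(_ l); rewrite !ffunE => /(congr1 val) /=.
  rewrite !inordK ?ltnS ?index_size // => ee.
  by rewrite -(nth_index 1 si) ee nth_index.
move: bb ei ei' Wi Wi' Gi Gi'.
case: (p _) => [[b v] x] /=; case: (p _) => [[b' v'] x'] /= <- ei ei' Wv Wv' Gx Gx'.
(* both points lie in [W * b * Gamma], and [C i l] commutes with the quotient of their
   [W]-parts modulo [L j.+1] *)
exists (c * (x^-1 * x')^-1), (u * ((a l)^-1 * (v' * v^-1) * a l)); split.
- by apply: GammaM => //; apply: GammaV; apply: GammaM => //; exact: GammaV.
- by apply: VU; [exact: interior_subset|exact: WV].
have -> : tau ^+ (m i' - m i) * a l * (c * (x^-1 * x')^-1) =
  tau ^+ (m i' - m i) * a l * c * (x^-1 * x')^-1 by word.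
rewrite e.
have -> : C i' l = (a l)^-1 * (v' * v^-1) * a l * C i l * (x^-1 * x').
  have -> : x' = b^-1 * v'^-1 * (a l * C i' l) by rewrite ei'; word.
  have -> : x = b^-1 * v^-1 * (a l * C i l) by rewrite ei; word.
  by word.
set y := (a l)^-1 * _ * a l; set z := x^-1 * x'.
have -> : a l * u * (C i l)^-1 * (y * C i l * z) * z^-1 =
  a l * u * ((C i l)^-1 * y) * C i l by word.
have LCi : L j (C i l)^-1 by apply/lcsV/LC; rewrite -ltnS ltn_ord.
by rewrite -(cong_central y LCi); word.
Qed.

Lemma recurrent_all (M : finType) j : recurrent M j.
Proof.
elim: j => [a U N U1|j]; last exact: recurrentS.
by exists N => // l; exists 1, 1; split=> //; exact: nbhs_singleton.
Qed.

End Recurrence.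

(** * Filling a term of the lower central series *)

Section Filling.
Context (G : topologicalGroupType) (Gamma : set G) (tau : G).
Hypothesis Gamma_subgroup : is_subgroup Gamma.
Hypothesis return_to_Gamma : forall U N, nbhs 1 U ->
  exists2 n, (N <= n)%N & exists c u, [/\ Gamma c, U u & tau ^+ n * c = u].
Hypothesis orbit_dense : forall b U, nbhs 1 U ->
  exists n c u, [/\ Gamma c, U u & tau ^+ n * c = b * u].
Hypothesis divisible_generate : forall H : set G, is_subgroup H ->
  (forall h, infinitely_divisible h -> H h) -> H tau -> H = [set: G].

Local Notation L := (lower_central G).

Variables (j : nat) (S : set G).
Hypothesis S_subgroup : is_subgroup S.
Hypothesis LS : L j.+3 `<=` S.
Hypothesis S_closed : forall r, L j.+2 r ->
  (forall U, nbhs 1 U -> exists2 u, U u & S (r * u)) -> S r.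
Hypothesis Gamma_S : forall c, Gamma c -> L j.+2 c -> S c.
Hypothesis comm_tau_S : forall f h, grhom j.+1 f -> infinitely_divisible h ->
  S (comm (f h) tau).

Let S1 : S 1. Proof. by case: S_subgroup. Qed.
Let SM x y : S x -> S y -> S (x * y).
Proof. by case: S_subgroup => _ + _; apply. Qed.
Let SV x : S x -> S x^-1.
Proof. by case: S_subgroup => _ _; apply. Qed.
Let GammaM x y : Gamma x -> Gamma y -> Gamma (x * y).
Proof. by case: Gamma_subgroup => _ + _; apply. Qed.
Let GammaV x : Gamma x -> Gamma x^-1.
Proof. by case: Gamma_subgroup => _ _; apply. Qed.

Let S_cong x y : x =[j.+3] y -> S x -> S y.
Proof. exact: subgroup_cong. Qed.

Lemma grhom_preimage f : grhom j.+2 f -> is_subgroup [set x | S (f x)].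
Proof.
move=> gf; split=> [|x y Sx Sy|x Sx] /=; first by rewrite (grhom1 gf).
  by apply: S_cong (SM Sx Sy); symmetry; exact: grhomM.
by apply: S_cong (SV Sx); symmetry; exact: grhomV.
Qed.

Lemma grhom_S_gen f : grhom j.+2 f -> S (f tau) ->
  (forall h, infinitely_divisible h -> S (f h)) -> forall x, S (f x).
Proof.
move=> gf ftau fh x.
by have /seteqP[_ /(_ x)] := divisible_generate (grhom_preimage gf) fh ftau; apply.
Qed.

Lemma grhom_S_dense f : grhom j.+2 f -> S (f tau) ->
  (forall c, Gamma c -> S (f c)) -> forall x, S (f x).
Proof.
move=> gf ftau fc x; apply: S_closed (grhom_in gf x) _ => U U1.
have Uf : \forall u \near 1, U (f u).
  by apply: (nbhs_word (grhom_cont gf)); rewrite (grhom1 gf).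
have [n [c [u [Gc Uu e]]]] := orbit_dense x Uf.
exists (f u) => //; apply: (S_cong (grhomM gf x u)); rewrite -e.
have [_ fM _] := grhom_preimage gf; apply: (fM); last exact: fc.
elim: n {e} => [|n IHn]; first by rewrite expg0 /= (grhom1 gf).
by rewrite expgS; exact: fM.
Qed.

(** By multilinearity the letters may be assumed to be [tau] or to have small roots.  If
    both of the first two letters of [comm k tau] are [tau], the commutator is trivial;
    otherwise [comm_tau_S] applies to one of them. *)
Lemma comm_tau_in k : L j.+1 k -> S (comm k tau).
Proof.
move=> Lk; pose K := [set k | L j.+1 k /\ S (comm k tau)].
suff [] : K k by [].
apply: (@comms_gen _ j K) Lk => [|k' Lk'|x s sj].
- split=> [|y z [Ly Ky] [Lz Kz]|y [Ly Ky]].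
  + by split; [exact: lcs1|rewrite comm1l].
  + split; first exact: lcsM.
    by apply: S_cong (SM Ky Kz); symmetry; exact: commMl.
  + split; first exact: lcsV.
    apply: S_cong (SV Ky).
    have := commMl tau Ly (lcsV Ly); rewrite mulgV comm1l => yc.
    by rewrite -[(comm y tau)^-1]mulg1 yc mulKg.
- by split; [exact: lcsS|exact/LS/lcs_comm].
split; first by rewrite -sj -add1n; exact: lcs_comms.
pose f y := comms y s.
have gf : grhom j.+1 f by rewrite -sj -add1n; exact: (grhom_comms s (@grhom_id G)).
apply: (grhom_S_gen (grhom_comm tau gf)) => [|h dh]; last exact: comm_tau_S.
case: s sj @f gf => [|b s] /= sj gf; first by rewrite /comm; word.
pose f b := comms (comm tau b) s.
have gf2 : grhom j.+1 f.
  by rewrite -sj -add1n addnS -addSn;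
    exact: (grhom_comms s (@grhom_commr G 1 tau I)).
apply: (grhom_S_gen (grhom_comm tau gf2)) => [|h dh]; last exact: comm_tau_S.
have -> : f tau = 1 by rewrite /f (_ : comm tau tau = 1) ?comms1 // /comm; word.
by rewrite comm1l.
Qed.

(** To replace [c] in [Gamma] by an arbitrary element it suffices, by density, to treat
    [tau].  The outer variable is then a product of [tau] and of
    elements with small roots; for such an element, [comm_expg] moves a large power to
    [tau], and for return times this power is close to [Gamma]. *)
Lemma comm_grhom_S f : grhom j.+1 f ->
  (forall c b, Gamma c -> S (comm (f c) b)) -> forall x b, S (comm (f x) b).
Proof.
move=> gf fG x b; apply: (grhom_S_dense (grhom_comm b gf)) => [|c]; last exact: fG.
apply: (grhom_S_gen (grhom_commr (grhom_in gf tau))) => [|h dh].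
  exact: comm_tau_in (grhom_in gf tau).
have gt := grhom_commr (grhom_in gf tau).
apply: S_closed (lcs_comm h (grhom_in gf tau)) _ => U /nbhs1_mul[V V1 VU].
have cf : continuous (fun p : G * G => (comm (f p.1) p.2)^-1).
  have c1 : continuous (fun p : G * G => f p.1).
    by move=> p; apply: continuous_comp; [exact: cvg_fst|exact: (grhom_cont gf)].
  have c2 : continuous (fun p : G * G => p.2) by move=> p; exact: cvg_snd.
  by rewrite /comm; repeat first
    [exact: c1 | exact: c2 | apply: mulg_cont | apply: invg_cont].
have := cf (1, 1) V; rewrite /= comm1r invg1 => /(_ V1)[[A B] /= [A1 B1] AB].
have V1t : \forall u \near 1, V (comm (f tau) u).
  by apply: (nbhs_word (grhom_cont gt)); rewrite /= comm1r.
have [N HN] := dh _ (filterI B1 V1t).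
have [n /HN[k [u [[Bk _] [_ Vu] e]]] [c [w [Gc Aw ew]]]] := return_to_Gamma N A1.
exists (comm (f tau) u * (comm (f w) k)^-1).
  by apply: VU => //; exact: (AB (w, k)).
apply: (S_cong _ (fG c^-1 k (GammaV Gc))).
have ew' : tau ^+ n = w * c^-1 by rewrite -ew mulgK.
have := comm_expg tau k n gf; rewrite ew' => e1.
have e2 : comm (f (w * c^-1)) k =[j.+3] comm (f w) k * comm (f c^-1) k.
  exact: (grhomM (grhom_comm k gf)).
have e3 : comm (f tau) (k ^+ n) =[j.+3] comm (f tau) h * comm (f tau) u.
  by rewrite (grhom_cong2 gt e) (grhomM gt).
have Lw : L j.+2 (comm (f w) k)^-1 by apply/lcsV/lcs_comm/(grhom_in gf).
rewrite mulgA -e3 e1 e2 (cong_central _ Lw) mulKg.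
reflexivity.
Qed.

Lemma Gamma_comms_S i c s : (i.+1 + size s = j.+2)%N -> Gamma c -> L i.+1 c ->
  S (comms c s).
Proof.
have [n sn] := ubnP (size s).
elim: n i c s sn => // n IHn i c [|x s] /= sn e Gc Lc.
  by apply: Gamma_S => //; rewrite -e addn0.
have GcommP y : Gamma y -> Gamma (comm c y).
  by move=> Gy; do ![apply: GammaM|apply: GammaV].
case/lastP: s sn e => [|s b] sn e.
  have {}e : i.+2 = j.+2 by rewrite -e addn1.
  case: e => ij; rewrite ij in Lc.
  have gf : grhom j.+2 (fun y => comm c y) by exact: grhom_commr.
  apply: (grhom_S_dense gf) => [|y Gy]; first exact: comm_tau_in.
  by apply: Gamma_S; [exact: GcommP|exact: lcs_comm].
rewrite /= size_rcons in sn e.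
have gf : grhom j.+1 (fun y => comms (comm c y) s).
  have -> : j.+1 = (i.+2 + size s)%N by apply/eqP; rewrite -eqSS -e !addSn !addnS.
  exact: (grhom_comms s (grhom_commr Lc)).
rewrite comms_rcons; apply: (comm_grhom_S gf) => y b' Gy.
rewrite -comms_rcons; apply: (IHn i.+1); rewrite ?size_rcons //.
- by rewrite -e !addSn !addnS.
- exact: GcommP.
- exact: lcs_comm.
Qed.

Lemma filling : L j.+2 `<=` S.
Proof.
apply: comms_gen => // x s; case/lastP: s => [//|s b].
rewrite size_rcons => -[sj]; rewrite comms_rcons.
have gf : grhom j.+1 (fun y => comms y s).
  by rewrite -sj -add1n; exact: (grhom_comms s (@grhom_id G)).
apply: (comm_grhom_S gf) => c b' Gc; rewrite -comms_rcons.
by apply: (@Gamma_comms_S 0) => //; rewrite size_rcons sj add1n.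
Qed.

End Filling.

(** * Realizing patterns along cubes *)

Section Patterns.
Context (G : topologicalGroupType) (Gamma : set G) (tau : G) (D M : finType).
Variable J : nat.

Local Notation L := (lower_central G).

Hypothesis nilpotent : L J = [set 1].
Hypothesis Gamma_subgroup : is_subgroup Gamma.
Hypothesis recurrence : recurrent Gamma tau M J.
Hypothesis return_to_Gamma : forall U N, nbhs 1 U ->
  exists2 n, (N <= n)%N & exists c u, [/\ Gamma c, U u & tau ^+ n * c = u].
Hypothesis orbit_dense : forall b U, nbhs 1 U ->
  exists n c u, [/\ Gamma c, U u & tau ^+ n * c = b * u].
Hypothesis divisible_generate : forall H : set G, is_subgroup H ->
  (forall h, infinitely_divisible h -> H h) -> H tau -> H = [set: G].

Implicit Types (I A : {set D}) (v w : M -> {set D} -> G) (j : nat).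

Let Gamma1 : Gamma 1. Proof. by case: Gamma_subgroup. Qed.
Let GammaM x y : Gamma x -> Gamma y -> Gamma (x * y).
Proof. by case: Gamma_subgroup => _ + _; apply. Qed.
Let GammaV x : Gamma x -> Gamma x^-1.
Proof. by case: Gamma_subgroup => _ _; apply. Qed.

Lemma congJ (x y : G) : x =[J] y -> x = y.
Proof. by rewrite /cong nilpotent /= => e; rewrite -(mulVKg x y) e mulg1. Qed.

(** The vertices of a cube with directions [I] are the subsets [A] of [I].  All points
    share the times [p], while each has its own perturbation [b l]; this is
    what makes different patterns at different points compatible.  The
    prescribed factor [v l A] is on the right: right multiplication commutes with the
    dynamics, and it is trivial for elements of [Gamma]. *)
Definition realizable j I v := forall (a : M -> G) U, nbhs 1 U ->
  exists (p : D -> nat) (b : M -> G) (c u : M -> {set D} -> G),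
  (forall l, U ((a l)^-1 * b l)) /\
  forall l A, A \subset I -> A != finset.set0 ->
    [/\ Gamma (c l A), U (u l A) &
        tau ^+ (\sum_(i in A) p i)%N * b l * c l A =[j] a l * v l A * u l A].

Lemma realizable_cong j I v w : (forall l A, v l A =[j] w l A) ->
  realizable j I v -> realizable j I w.
Proof.
move=> vw rv a U U1; have [p [b [c [u [Hb H]]]]] := rv a U U1.
exists p, b, c, u; split=> // l A AI A0; have [? ? e] := H l A AI A0.
by split=> //; rewrite e vw.
Qed.

Lemma realizable_Gamma j I v :
  (forall l A, A \subset I -> A != finset.set0 -> Gamma (v l A)) -> realizable j I v.
Proof.
move=> Gv a U U1; exists (fun=> 0%N), a, v, (fun _ _ => 1).
have {}U1 := nbhs_singleton U1.
split=> [l|l A AI A0]; first by rewrite mulVg.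
by split=> //; [exact: Gv|rewrite big1 // mul1g mulg1].
Qed.

Let near_conj I (c : M -> {set D} -> G) U : nbhs 1 U ->
  \forall u \near 1, U u /\ forall l A, U ((c l A)^-1 * u * c l A).
Proof.
move=> U1; apply: filterI => //; apply: filter_forall => l; apply: filter_forall => A.
by have := nbhs1_conj (c l A)^-1 U1; rewrite invgK.
Qed.

Let tau_sumD A (p q : D -> nat) (x y z : G) :
  tau ^+ (\sum_(i in A) (p i + q i))%N * x * (y * z) =
  tau ^+ (\sum_(i in A) p i)%N * (tau ^+ (\sum_(i in A) q i)%N * x * y) * z.
Proof. by rewrite big_split expgnDr; word. Qed.

(** The second pattern is realized from the points that already realize the first one;
    the times add up. *)
Lemma realizableM j I v w : (forall l A, L j (w l A)) ->
  realizable j.+1 I v -> realizable j.+1 I w ->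
  realizable j.+1 I (fun l A => v l A * w l A).
Proof.
move=> Lw rv rw a U /nbhs1_mul[V V1 VU].
have [p [b [c [u [Hb H]]]]] := rv a V V1.
have [q [b' [c' [u' [Hb' H']]]]] := rw b _ (near_conj I c V1).
exists (fun i => p i + q i)%N, b', (fun l A => c' l A * c l A).
exists (fun l A => u l A * ((c l A)^-1 * u' l A * c l A)).
split=> [l|l A AI A0].
  rewrite (_ : _ * _ = ((a l)^-1 * b l) * ((b l)^-1 * b' l)); last by word.
  by apply: VU => //; have [] := Hb' l.
have [Gc Vu e] := H l A AI A0; have [Gc' [_ Vu'] e'] := H' l A AI A0.
split; [exact: GammaM|exact: VU|].
rewrite tau_sumD e'.
move: (c l A) (u l A) (u' l A) (v l A) (w l A) (Lw l A) e => x y y' z t Lt e.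
have -> : tau ^+ (\sum_(i in A) p i)%N * (b l * t * y') * x =
  (tau ^+ (\sum_(i in A) p i)%N * b l * x) * x^-1 * t * (y' * x) by word.
rewrite e.
have -> : a l * z * y * x^-1 * t * (y' * x) = a l * z * (y * x^-1 * t) * (y' * x) by word.
rewrite (cong_central (y * x^-1) Lt).
by word.
Qed.

(** Errors in [L j.+1] are removed by a second, much finer application of patterns
    with values in [L j.+1]. *)
Lemma realizable_exact j I v :
  (forall w, (forall l A, L j.+1 (w l A)) -> realizable J I w) ->
  realizable j.+1 I v -> realizable J I v.
Proof.
move=> rw rv a U /nbhs1_mul[V V1 VU].
have [p [b [c [u [Hb H]]]]] := rv a V V1.
pose d l A := (tau ^+ (\sum_(i in A) p i)%N * b l * c l A)^-1 * (a l * v l A * u l A).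
pose w l A := if (A \subset I) && (A != finset.set0)
  then c l A * d l A * (c l A)^-1 else 1.
have Lw l A : L j.+1 (w l A).
  rewrite /w; case: ifP => [/andP[AI A0]|_]; last exact: lcs1.
  by apply: lcsJ; have [_ _] := H l A AI A0.
have [q [b' [c' [u' [Hb' H']]]]] := rw w Lw b _ (near_conj I c V1).
exists (fun i => p i + q i)%N, b', (fun l A => c' l A * c l A).
exists (fun l A => u l A * ((c l A)^-1 * u' l A * c l A)).
split=> [l|l A AI A0].
  rewrite (_ : _ * _ = ((a l)^-1 * b l) * ((b l)^-1 * b' l)); last by word.
  by apply: VU => //; have [] := Hb' l.
have [Gc Vu _] := H l A AI A0; have [Gc' [_ Vu'] e'] := H' l A AI A0.
split; [exact: GammaM|exact: VU|].
rewrite tau_sumD e' /w AI A0 /= /d.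
by word.
Qed.

Definition single (l0 : M) A0 (r : G) : M -> {set D} -> G :=
  fun l A => if (l == l0) && (A == A0) then r else 1.

Lemma single_in j l0 A0 r l A : L j r -> L j (single l0 A0 r l A).
Proof. by rewrite /single; case: ifP => // *; exact: lcs1. Qed.

Lemma singleM j I l0 A0 r s : L j s ->
  realizable j.+1 I (single l0 A0 r) -> realizable j.+1 I (single l0 A0 s) ->
  realizable j.+1 I (single l0 A0 (r * s)).
Proof.
move=> Ls Rr Rs.
apply: realizable_cong (realizableM (fun l A => single_in l0 A0 l A Ls) Rr Rs) => l A.
by rewrite /single; case: ifP => // _; rewrite mulg1.
Qed.

Lemma single_closed j I l0 A0 r :
  (forall U, nbhs 1 U -> exists2 u, U u & realizable j I (single l0 A0 (r * u))) ->
  realizable j I (single l0 A0 r).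
Proof.
move=> Hr a U U1; have /nbhs1_mul[V V1 VU] := U1.
have [u0 Vu0 /(_ a _ (filterI U1 V1))[p [b [c [u [Hb H]]]]]] := Hr _ V1.
exists p, b, c, (fun l A => single l0 A0 u0 l A * u l A).
split=> [l|l A AI A0']; first by have [] := Hb l.
have [Gc [Uu Vu] e] := H l A AI A0'; split=> //.
  by rewrite /single; case: ifP => _; [exact: VU|rewrite mul1g].
by rewrite e /single; case: ifP => _; word.
Qed.

(** The time in direction [i0] is a return time [n] of all points, and the vertex
    [A0 :\ i0] is displaced by the small [k^-1].  After time [n] this displacement has
    been conjugated by an element of [Gamma] that is close to a conjugate of
    [tau ^+ n]; so at [A0] appears the commutator of [k] and [tau ^+ n], which
    need not be small. *)
Lemma single_comm j I l0 A0 i0 r : i0 \in A0 -> L j.+2 r ->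
  (forall w, (forall l A, L j.+1 (w l A)) -> realizable J (I :\ i0) w) ->
  (forall U, nbhs 1 U -> exists N, forall n, (N <= n)%N ->
     exists k u, [/\ L j.+1 k, U k, U u & comm k (tau ^+ n) =[j.+3] r * u]) ->
  realizable j.+3 I (single l0 A0 r).
Proof.
move=> i0A0 Lr rw Hr a U /nbhs1_mul[V' V'1 VU'].
have {VU'}[V V1 VU] : exists2 V, nbhs 1 V &
    forall x y z t, V x -> V y -> V z -> V t -> U (x * y * z * t).
  have /nbhs1_mul[V V1 VU] := V'1; exists V => // x y z t Vx Vy Vz Vt.
  by rewrite -(mulgA (x * y)); apply: VU'; exact: VU.
have VU2 x y : V x -> V y -> U (x * y).
  by move=> Vx Vy; have := VU _ _ _ _ Vx Vy (nbhs_singleton V1) (nbhs_singleton V1); rewrite !mulg1.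
have VU1 x : V x -> U x.
  by move=> Vx; have := VU2 _ _ Vx (nbhs_singleton V1); rewrite mulg1.
have [N HN] := Hr _ (filterI V1 (nbhs1_inv V1)).
have [n /HN[k [u0 [Lk [_ Vk] [Vu0 _] ek]]] /choice[g Hg]] := recurrence a N V1.
have {Hg}/choice[v0 Hv] := Hg.
(* the displacement of the smaller cube, which may also involve its vertex [set0]; there
   it is absorbed into the points [a'] *)
pose kap := single l0 (A0 :\ i0) k^-1.
pose a' l := a l * kap l finset.set0.
pose w l A := (kap l finset.set0)^-1 * kap l A.
have Lkap l A : L j.+1 (kap l A) by apply: single_in; exact: lcsV.
have Lw l A : L j.+1 (w l A) by apply: lcsM => //; exact: lcsV.
have [p' [b [c' [t' [Hb H]]]]] := rw w Lw a' _ (near_conj I (fun l _ => g l) V1).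
pose c l A := if A == finset.set0 then 1 else c' l A.
pose o l A := if A == finset.set0 then (a' l)^-1 * b l else t' l A.
have Hc l A : A \subset I :\ i0 -> [/\ Gamma (c l A), V (o l A),
    V ((g l)^-1 * o l A * g l) &
    tau ^+ (\sum_(i in A) p' i)%N * b l * c l A = a l * kap l A * o l A].
  rewrite /c /o; have [->|A0' AI] := eqVneq A finset.set0.
    move=> _; have [Vb Vgb] := Hb l; split=> //; first exact: (Vgb l finset.set0).
    by rewrite big_set0 /a'; word.
  have [Gc [Vo Vgo] /congJ ->] := H l A AI A0'; split=> //; first exact: (Vgo l A).
  by rewrite /a' /w; word.
have Vkap l A : V (kap l A).
  by rewrite /kap /single; case: ifP => // _; exact: nbhs_singleton.
exists (fun i => if i == i0 then n else p' i), b.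
exists (fun l A => if i0 \in A then c l (A :\ i0) * g l else c l A).
exists (fun l A => let o1 := (g l)^-1 * o l (A :\ i0) * g l in
  if i0 \in A then
    if (l == l0) && (A == A0) then k^-1 * v0 l * u0 * o1 else v0 l * o1
  else kap l A * o l A).
split=> [l|l A AI An0].
  have [Vb _] := Hb l; rewrite (_ : _ * _ = kap l finset.set0 * ((a' l)^-1 * b l)).
    by apply: VU2.
  by rewrite /a'; word.
case: ifPn => i0A; last first.
  have AI0 : A \subset I :\ i0 by rewrite subsetD1 AI.
  have [Gc Vo _ e] := Hc l A AI0; split=> //; first exact: VU2.
  rewrite (eq_bigr p') => [|i iA]; last first.
    by case: eqP => // ii0; move: i0A; rewrite -ii0 iA.
  have AA0 : (A == A0) = false by apply/eqP => AA0; move: i0A; rewrite AA0 i0A0.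
  by rewrite e /single AA0 andbF; word.
have AI0 : A :\ i0 \subset I :\ i0 by exact: finset.setSD.
have [Gc Vo Vo1 e] := Hc l (A :\ i0) AI0; have [Gg Vv /congJ eg] := Hv l.
have eA : (A :\ i0 == A0 :\ i0) = (A == A0).
  by apply/eqP/eqP => [AA0|->//]; rewrite -(finset.setD1K i0A) AA0 finset.setD1K.
split; [exact: GammaM| |].
  by rewrite /=; case: ifP => _; [apply: VU => //; exact: nbhs_singleton|exact: VU2].
rewrite (big_setD1 i0) //= eqxx (eq_bigr p') => [|i]; last first.
  by rewrite !inE => /andP[/negPf->].
rewrite expgnDr.
have -> : forall x, tau ^+ n * x * b l * (c l (A :\ i0) * g l) =
  tau ^+ n * (x * b l * c l (A :\ i0)) * g l by move=> x; word.
rewrite e /kap /single eA.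
set o1 := o l _; set q := v0 l; set y := (g l)^-1; set x := a l.
have ey : tau ^+ n = x * q * y * x^-1 by rewrite /x /q /y -eg; word.
rewrite ey; case: ifP => [_|_]; last by word.
have -> : x * q * y * x^-1 * (x * k^-1 * o1) * g l =
  x * q * k^-1 * comm k y * (y * o1 * g l) by rewrite /comm /y; word.
have gk := grhom_commr Lk.
have -> : comm k y =[j.+3] comm k q^-1 * (r * u0).
  have -> : y = q^-1 * (x^-1 * tau ^+ n * x) by rewrite ey; word.
  rewrite !(grhomM gk) ek (grhomV x gk) -(mulgA (comm k x)^-1).
  by rewrite (cong_central (r * u0) (lcs_comm x Lk)) mulKg.
have -> : x * q * k^-1 * (comm k q^-1 * (r * u0)) * (y * o1 * g l) =
  x * (k^-1 * q * r) * u0 * (y * o1 * g l) by rewrite /comm; word.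
by rewrite (cong_central (k^-1 * q) Lr); word.
Qed.

(** For a single vertex, [single_comm] needs patterns on a cube with one direction less,
    but with values one term higher in the series; so the gap between [#|I|] and [j]
    is preserved. *)
Theorem realizable_patterns I j v : (#|I| < j)%N -> (forall l A, L j (v l A)) ->
  realizable J I v.
Proof.
have [n In] := ubnP #|I|.
elim: n I In j v => // n IHn I In j v.
have [m jm] := ubnP (J - j)%N.
elim: m j v jm => // m IHm j v jm Ij Lv.
have [Jj|jJ] := leqP J j.
  apply: realizable_Gamma => l A _ _.
  by have := lcs_le Jj (Lv l A); rewrite nilpotent => ->.
have [I0|In0] := eqVneq I finset.set0.
  apply: realizable_Gamma => l A; rewrite I0 finset.subset0 => /eqP ->.
  by rewrite eqxx.
case: j => [|[|j]] in jm Ij Lv jJ *.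
- by [].
- by move: Ij; rewrite ltnS leqn0 cards_eq0 (negPf In0).
apply: (@realizable_exact j.+2) => [w Lw|].
  apply: (IHm j.+3) => //; last exact: ltnW.
  by rewrite subnS -ltnS prednK ?subn_gt0 // ltnW.
have spot l0 A0 r : A0 \subset I -> A0 != finset.set0 -> L j.+2 r ->
    realizable j.+3 I (single l0 A0 r).
  move=> A0I /finset.set0Pn[i0 i0A0] Lr.
  have II : (#|I :\ i0| < n)%N.
    by rewrite -ltnS (leq_trans _ In) // ltnS [X in (_ < X)%N](cardsD1 i0) (fintype.subsetP A0I).
  have IIj : (#|I :\ i0| < j.+1)%N.
    by rewrite -ltnS (leq_trans _ Ij) // ltnS [X in (_ < X)%N](cardsD1 i0) (fintype.subsetP A0I).
  pose S := [set r | [/\ L j.+2 r, realizable j.+3 I (single l0 A0 r)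
                         & realizable j.+3 I (single l0 A0 r^-1)]].
  suff /(_ r Lr)[] : L j.+2 `<=` S by [].
  have commS x y : L j.+2 x -> L j.+2 y -> realizable j.+3 I (single l0 A0 (x * y)) ->
      realizable j.+3 I (single l0 A0 (y * x)).
    move=> Lx Ly; apply: realizable_cong => l A; rewrite /single; case: ifP => // _.
    exact: cong_central.
  apply: (@filling G Gamma tau Gamma_subgroup return_to_Gamma orbit_dense
     divisible_generate j S) => [|r' Lr'|r' Lr' Hr'|c Gc Lc|f h gf dh].
  - split=> [|x y [Lx Rx Rx'] [Ly Ry Ry']|x [Lx Rx Rx']].
    + split; rewrite ?invg1; [exact: lcs1|apply: realizable_Gamma..];
        by rewrite // /single => l A _ _; case: ifP.
    + split; [exact: lcsM|exact: singleM|rewrite invgM].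
      by apply: singleM => //; exact: lcsV.
    + by split; rewrite ?invgK //; exact: lcsV.
  - have Rr x : L j.+3 x -> realizable j.+3 I (single l0 A0 x).
      move=> Lx; apply: (@realizable_cong _ _ (fun _ _ => 1)) => [l A|].
        by rewrite /single; case: ifP => // _; symmetry; apply/cong1P.
      exact: realizable_Gamma.
    by split; [exact: lcsS|exact: Rr|apply: Rr; exact: lcsV].
  - split=> //; apply: single_closed => U U1.
      by have [u Uu [_ Ru _]] := Hr' U U1; exists u.
    have [u Uu [Lu _ Ru]] := Hr' _ (nbhs1_inv U1); exists u^-1 => //.
    have Lu' : L j.+2 u by rewrite -(mulKg r' u); apply: lcsM => //; exact: lcsV.
    by apply: commS; rewrite -?invgM //; exact: lcsV.
  - by split=> //; apply: realizable_Gamma => l A _ _; rewrite /single; case: ifP => // _;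
      exact: GammaV.
  - have Rf h' : infinitely_divisible h' ->
        realizable j.+3 I (single l0 A0 (comm (f h') tau)).
      move=> dh'; have Lf := lcs_comm tau (grhom_in gf h').
      have gft := grhom_comm tau gf.
      apply: (@single_comm j I l0 A0 i0) => // [w Lw|U U1]; first exact: (IHn _ II j.+1).
      have Vf : \forall u \near 1, U (f u).
        by apply: (nbhs_word (grhom_cont gf)); rewrite (grhom1 gf).
      have Vt : \forall u \near 1, U (comm (f u) tau).
        by apply: (nbhs_word (grhom_cont gft)); rewrite (grhom1 gft).
      have [N HN] := dh' _ (filterI Vf Vt); exists N => N' /HN[k [u [[Uk _] [_ Uu] e]]].
      exists (f k), (comm (f u) tau); split=> //; first exact: (grhom_in gf).
      by rewrite (comm_expg k tau N' gf) (grhom_cong2 gft e) (grhomM gft).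
    split; [exact/lcs_comm/(grhom_in gf)|exact: Rf|].
    have [_ _ /(_ h dh) dV] := @infinitely_divisible_subgroup G.
    apply: realizable_cong (Rf _ dV) => l A; rewrite /single; case: ifP => // _.
    exact: (grhomV h (grhom_comm tau gf)).
have spot' l0 A0 : realizable j.+3 I (single l0 A0 (v l0 A0)).
  have [/andP[AI An0]|nA] := boolP ((A0 \subset I) && (A0 != finset.set0)).
    exact: spot.
  apply: realizable_Gamma => l A AI An0; rewrite /single; case: ifP => // /andP[_ /eqP AA].
  by move: nA; rewrite -AA AI An0.
pose vs (s : seq (M * {set D})) l A := if (l, A) \in s then v l A else 1.
suff /(_ (enum {: M * {set D}})) : forall s, realizable j.+3 I (vs s).
  by apply: realizable_cong => l A; rewrite /vs mem_enum.
elim=> [|[l0 A0] s IHs]; first by apply: realizable_Gamma => l A _ _; rewrite /vs in_nil.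
have [ls|ls] := boolP ((l0, A0) \in s).
  apply: realizable_cong IHs => l A; rewrite /vs inE; case: eqP => // -[-> ->].
  by rewrite ls.
have Lvs l A : L j.+2 (vs s l A) by rewrite /vs; case: ifP => // _; exact: lcs1.
apply: realizable_cong (realizableM Lvs (spot' l0 A0) IHs) => l A.
rewrite /vs /single inE xpair_eqE; case: ifP => [/andP[/eqP -> /eqP ->]|_].
  by rewrite (negPf ls) mulg1.
by rewrite mul1g.
Qed.

End Patterns.

(** * Small roots in Lie groups *)

Section StrictDerivative.
Context (R : realType).

Local Open Scope ring_scope.

Lemma row_entry_le n (x : 'rV[R]_n) i : `|x 0 i| <= `|x|.
Proof.
rewrite [leRHS]/Num.Def.normr/= mx_normrE.
exact: (le_bigmax _ (fun ij => `|x ij.1 ij.2|) (0, i)).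
Qed.

Lemma row_norm_le n (x : 'rV[R]_n) r :
  0 <= r -> (forall i, `|x 0 i| <= r) -> `|x| <= r.
Proof.
move=> r0 xr; rewrite [leLHS]/Num.Def.normr/= mx_normrE bigmax_le// => -[i j] _ /=.
by rewrite ord1.
Qed.

Lemma is_derive_line (V W : normedModType R) (f : V -> W) p q (t : R) :
  differentiable f (p + t *: q) ->
  is_derive t 1 (fun s : R => f (p + s *: q)) ('D_q f (p + t *: q)).
Proof.
move=> df.
have e : (fun h : R => h^-1 *:
      (((fun s : R => f (p + s *: q)) \o shift t) (h *: 1) - f (p + t *: q)))
   = (fun h : R => h^-1 *: ((f \o shift (p + t *: q)) (h *: q) - f (p + t *: q))).
  apply/funext => h /=; congr (_ *: (f _ - _)).
  have -> : h *: (1 : R) = h by exact: mulr1.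
  by rewrite scalerDl addrCA.
split; last by rewrite /derive e.
by rewrite /derivable e; exact: diff_derivable.
Qed.

Lemma is_derive_row n (f : R -> 'rV[R]_n) (t : R) df i :
  is_derive t 1 f df -> is_derive t 1 (fun s => f s 0 i) (df 0 i).
Proof.
move=> [fd fv]; have /derivable_mxP fd' := fd.
by split; [exact: fd'|rewrite -fv derive_mx // mxE].
Qed.

(** Each partial derivative of [m] in the second variable is continuous, and at [(e, e)]
    it is the basis vector; the mean value theorem turns this into a
    uniform estimate. *)
Lemma mul_estimate n (m : 'rV[R]_n * 'rV[R]_n -> 'rV[R]_n) (W : set ('rV[R]_n * 'rV[R]_n))
    (e : 'rV[R]_n) (eta : R) :
  0 < eta -> nbhs (e, e) W -> Ck_on 1 W m ->
  (\forall x \near e, m (x, e) = x) -> (\forall y \near e, m (e, y) = y) ->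
  exists2 r, 0 < r & forall x y : 'rV[R]_n, `|x - e| < r -> `|y - e| < r ->
    W (x, y) /\ `|m (x, y) - x - (y - e)| <= eta * `|y - e|.
Proof.
move=> eta0 We [dm Dm] mx my.
pose g i p := 'D_((0, 'e_i) : 'rV[R]_n * 'rV[R]_n) m p.
have ge i : g i (e, e) = 'e_i.
  apply: cvg_lim => //; apply: cvg_near_cst.
  have : \forall h \near (0 : R), m (e, e + h *: 'e_i) = e + h *: 'e_i.
    have c : (e + h *: 'e_i : 'rV[R]_n) @[h --> (0 : R)] --> e + (0 : R) *: 'e_i.
      by apply: cvgD; [exact: cvg_cst|apply: cvgZr_tmp; exact: cvg_id].
    by rewrite scale0r addr0 in c; exact: (c _ my).
  move=> /nbhs_dnbhs He; near=> h; rewrite /=.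
  have -> : m (h *: (0, 'e_i) + (e, e)) = h *: 'e_i + e.
    rewrite (_ : h *: (0, 'e_i) + (e, e) = (e, e + h *: 'e_i)).
      by rewrite [RHS]addrC; near: h; exact: He.
    by congr (_, _) => /=; rewrite ?scaler0 ?add0r // addrC.
  rewrite (nbhs_singleton my) addrK scalerA mulVf ?scale1r //.
  by near: h; exact: nbhs_dnbhs_neq.
have near_g : \forall p \near (e, e), forall i : 'I_n, `|'e_i - g i p| <= eta / n.+1%:R.
  unshelve refine (@filter_forall _ 'I_n
    (fun (i : 'I_n) p => `|'e_i - g i p| <= eta / n.+1%:R) (nbhs (e, e)) _ _).
  move=> i; have c : g i p @[p --> (e, e)] --> g i (e, e).
    exact: (Dm (0, 'e_i) (e, e) (nbhs_singleton We)).
  by move: c; rewrite ge => /cvgrPdist_le; apply; rewrite divr_gt0.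
have near_mx : \forall p \near (e, e), m (p.1, e) = p.1 by exact: (cvg_fst mx).
have {near_mx near_g} : \forall p \near (e, e),
    [/\ W p, m (p.1, e) = p.1 & forall i : 'I_n, `|'e_i - g i p| <= eta / n.+1%:R].
  by near=> p; split; near: p.
move=> /nbhs_ballP[r /= r0 Hr]; exists r => // x y xr yr.
set w := y - e; pose q : 'rV[R]_n * 'rV[R]_n := (0, w).
have pt (t : R) : (x, e) + t *: q = (x, e + t *: w).
  by congr (_, _) => /=; rewrite ?scaler0 ?addr0.
have Hp (t : R) : 0 <= t <= 1 -> [/\ W (x, e + t *: w), m (x, e) = x
    & forall i : 'I_n, `|'e_i - g i (x, e + t *: w)| <= eta / n.+1%:R].
  move=> /andP[t0 t1]; apply: (Hr (x, e + t *: w)).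
  split; rewrite -ball_normE /=; first by rewrite distrC.
  rewrite opprD addrA subrr add0r normrN normrZ ger0_norm //.
  by apply: le_lt_trans yr; rewrite ler_piMl.
have w01 : 0 <= (1 : R) <= 1 by rewrite ler01 lexx.
split; first by have [+ _ _] := Hp 1 w01; rewrite scale1r addrC subrK.
have dF (t : R) : 0 <= t <= 1 ->
    is_derive t 1 (fun s : R => m ((x, e) + s *: q)) ('D_q m ((x, e) + t *: q)).
  by move=> /Hp[Wt _ _]; apply: is_derive_line; apply: dm; rewrite pt.
apply: row_norm_le => [|i]; first by rewrite mulr_ge0 // ltW.
have [t t01 e1] : exists2 t, t \in `[0, 1] &
    m ((x, e) + (1 : R) *: q) 0 i - m ((x, e) + (0 : R) *: q) 0 i =
    ('D_q m ((x, e) + t *: q)) 0 i * (1 - 0).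
  apply: (@MVT_segment _ (fun s : R => m ((x, e) + s *: q) 0 i)
     (fun t => ('D_q m ((x, e) + t *: q)) 0 i)) => // [t t01|].
    apply: is_derive_row; apply: dF; move: t01; rewrite in_itv /= => /andP[t0 t1].
    by rewrite !ltW.
  apply: derivable_within_continuous => t; rewrite in_itv /= => t01.
  by have [] := is_derive_row i (dF t t01).
rewrite in_itv /= in t01; have [Wt mxe gt] := Hp t t01.
move: e1; rewrite !pt scale0r scale1r addr0 subr0 mulr1 mxe => e1.
rewrite [X in m (x, X)](_ : y = e + w); last by rewrite addrC subrK.
rewrite !mxE e1 deriveE; last exact: dm.
have -> : q = \sum_j w 0 j *: (0, 'e_j).
  apply: injective_projections.
    rewrite (big_morph fst (id1 := 0) (op1 := +%R)) // big1 // => j _ /=.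
    by rewrite scaler0.
  by rewrite (big_morph snd (id1 := 0) (op1 := +%R)) //= -row_sum_delta.
rewrite linear_sum /= [in X in _ - X](_ : y 0 i - e 0 i = w 0 i); last by rewrite !mxE.
set p := (x, e + t *: w).
have -> : (\sum_j 'd m p (w 0 j *: (0, 'e_j))) 0 i - w 0 i =
    (\sum_j w 0 j *: (g j p - 'e_j)) 0 i.
  rewrite [in w 0 i](row_sum_delta w) !summxE -sumrB; apply: eq_bigr => j _.
  by rewrite linearZ /= -deriveE ?scalerBr ?mxE //; exact: dm.
apply: le_trans (row_entry_le _ i) _; apply: le_trans (ler_norm_sum _ _ _) _.
apply: (@le_trans _ _ (\sum_(j < n) `|w| * (eta / n.+1%:R))).
  apply: ler_sum => j _; rewrite normrZ distrC.
  by apply: ler_pM => //; exact: row_entry_le.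
rewrite sumr_const card_ord -[leLHS]mulr_natr -mulrA mulrC ler_wpM2r //.
by rewrite mulrAC ler_pdivrMr ?ltr0n // ler_wpM2l ?ler_nat // ltW.
Unshelve. all: by end_near.
Qed.

End StrictDerivative.

Section SmallRoots.
Context (R : realType) (G : lieGroupType R).

(** In a chart around [1] multiplication is a perturbation of addition; [N g] is the
    distance of [g] from [1] in the chart and [C] is its domain.  The [n]-th power of the
    element with coordinates [h / n] differs from [h] by at most a quarter of [N h];
    the remaining factor [h'] is then bounded by a third of it. *)
Lemma lie_local_norm : exists (N : G -> R) (C : set G) (r : R), [/\ (0 < r)%R,
  forall g, (0 <= N g)%R,
  forall s, (0 < s)%R -> \forall g \near 1, C g /\ (N g < s)%R,
  forall U, nbhs 1 U -> exists2 s : R, (0 < s)%R & forall g, C g -> (N g < s)%R -> U g &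
  forall h n, C h -> (N h < r)%R -> (0 < n)%N -> exists k h',
    [/\ h = k ^+ n * h', C k, (N k = N h / n%:R)%R, C h' & (N h' <= N h / 2)%R]].
Proof.
have [c Ac c1] := @lie_atlas_cover R G 1.
pose phi := chart_map c; pose psi := chart_inv c; pose e := phi 1.
have psi1 : psi e = 1 by exact: chart_mapK.
have cod_e : chart_cod c e by exists 1.
have near_cod : nbhs e (chart_cod c) by apply: open_nbhs_nbhs; split => //; exact: chart_cod_open.
have near_dom : nbhs 1 (chart_dom c) by apply: open_nbhs_nbhs; split => //; exact: chart_dom_open.
have cphi : phi x @[x --> (1 : G)] --> e by exact: chart_map_continuous.
have cpsi : psi u @[u --> e] --> (1 : G).
  by rewrite -psi1; apply: chart_inv_continuous.
pose W := [set p : 'rV[R]_lie_dim * 'rV[R]_lie_dim |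
  [/\ chart_cod c p.1, chart_cod c p.2 & chart_dom c (psi p.1 * psi p.2)]].
pose m (p : 'rV[R]_lie_dim * 'rV[R]_lie_dim) := phi (psi p.1 * psi p.2).
have We : nbhs (e, e) W.
  have n1 : \forall p \near (e, e), chart_cod c p.1 by exact: (cvg_fst near_cod).
  have n2 : \forall p \near (e, e), chart_cod c p.2 by exact: (cvg_snd near_cod).
  have n3 : \forall p \near (e, e), chart_dom c (psi p.1 * psi p.2).
    have cm : (psi p.1 * psi p.2) @[p --> (e, e)] --> (1 * 1 : G).
      apply: (@cvg_comp _ _ _ (fun p => (psi p.1, psi p.2))
        (fun q : G * G => q.1 * q.2) _ (nbhs ((1 : G), (1 : G))));
        last exact: (@mulg_continuous G (1, 1)).
      by apply: cvg_pair; apply: cvg_comp cpsi; [exact: cvg_fst|exact: cvg_snd].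
    by rewrite mulg1 in cm; exact: cm.
  by near=> p; split; near: p.
have smooth1 : Ck_on 1 W m by exact: (@lie_mul_smooth R G c c c Ac Ac Ac 1%N).
have mx : \forall x \near e, m (x, e) = x.
  by apply: filterS near_cod => _ [g dg <-]; rewrite /m /= psi1 mulg1 /psi chart_mapK.
have my : \forall x \near e, m (e, x) = x.
  by apply: filterS near_cod => _ [g dg <-]; rewrite /m /= psi1 mul1g /psi chart_mapK.
have eta0 : (0 < 4^-1 :> R)%R by rewrite invr_gt0.
have [d d0 Hd] := mul_estimate eta0 We smooth1 mx my.
pose N g := `|phi g - e|%R; pose B s := [set g | chart_dom c g /\ (N g < s)%R].
have B1 s : (0 < s)%R -> nbhs 1 (B s).
  move=> s0; apply: filterI => //; have /cvgrPdist_lt/(_ s s0) := cphi.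
  by apply: filterS => x; rewrite /N distrC.
have BU U : nbhs 1 U -> exists2 s : R, (0 < s)%R & forall g, chart_dom c g -> (N g < s)%R -> U g.
  move=> /cpsi /nbhs_ballP[s /= s0 Hs]; exists s => // g dg Ng.
  rewrite -(chart_mapK dg); apply: (Hs (phi g)).
  by rewrite -ball_normE /= distrC.
have Bmul g h : B d g -> B d h -> chart_dom c (g * h) /\
    (`|phi (g * h)%g - phi g - (phi h - e)| <= 4^-1 * N h)%R.
  move=> [dg Ng] [dh Nh]; have [[_ _]] := Hd _ _ Ng Nh.
  by rewrite /m /= /psi !chart_mapK.
have Bpsi u : (`|u - e| < d)%R -> chart_dom c (psi u) /\ phi (psi u) = u.
  move=> ue; have [[/= [g dg gu] _ _] _] := Hd _ _ ue ue.
  by rewrite -gu /psi chart_mapK.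
(* the estimate is applied to the remaining factor, a quotient of small elements *)
have [r [r0 rd Br]] : exists r, [/\ (0 < r)%R, (r <= d)%R
    & forall g h, B r g -> B r h -> B d (g^-1 * h)%g].
  have /nbhs1_mul[V V1 VB] := B1 d d0.
  have [s s0 sV] := BU _ (filterI V1 (nbhs1_inv V1)).
  exists (Num.min s d); split; [by rewrite lt_min s0|by rewrite ge_min lexx orbT|].
  move=> g h [dg Ng] [dh Nh]; rewrite !lt_min in Ng Nh.
  have [_ Vg] : V g /\ V g^-1 by apply: sV => //; case/andP: Ng.
  have [Vh _] : V h /\ V h^-1 by apply: sV => //; case/andP: Nh.
  exact: VB.
(* powers of the approximate root stay within twice the norm of [h] *)
exists N, (chart_dom c), (r / 2)%R.
split=> // [|g|h n dh Nh n0]; [by rewrite divr_gt0|exact: normr_ge0|].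
have nR : (0 < n%:R :> R)%R by rewrite ltr0n.
pose w := (n%:R^-1 *: (phi h - e))%R; pose k := psi (e + w)%R.
have Nw : (`|w| = N h / n%:R)%R by rewrite normrZ ger0_norm ?invr_ge0 // mulrC.
have Nh0 : (0 <= N h)%R by exact: normr_ge0.
have Nhn : (N h / n%:R <= N h)%R by rewrite ler_pdivrMr // ler_peMr // ler1n.
have hd : (N h < d / 2)%R by rewrite (lt_le_trans Nh) // ler_pM2r ?invr_gt0.
have [dk phik] : chart_dom c k /\ phi k = (e + w)%R.
  by apply: Bpsi; rewrite addrC addKr Nw; lra.
have Nk : N k = (N h / n%:R)%R by rewrite /N phik addrC addKr.
have pow i : (i <= n)%N -> chart_dom c (k ^+ i) /\
    (`|phi (k ^+ i)%g - e - i%:R *: w| <= i%:R * (4^-1 * `|w|))%R.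
  elim: i => [|i IHi] ile; first by rewrite expg0 subrr scale0r subr0 normr0 mul0r.
  have [di ei] := IHi (ltnW ile).
  have Ni : (N (k ^+ i)%g < d)%R.
    rewrite /N -[X in (`|X| < _)%R](subrK (i%:R *: w)%R); apply: le_lt_trans (ler_normD _ _) _.
    rewrite normrZ ger0_norm //.
    have : (i%:R * `|w| <= N h)%R.
      by rewrite Nw mulrA ler_pdivrMr // mulrC ler_wpM2l // ler_nat ltnW.
    rewrite mulrCA in ei; move: ei hd Nh0 => /=.
    move: (`|_ - _ - _|)%R (i%:R * `|w|)%R => x y; lra.
  have Nkd : (N k < d)%R by rewrite Nk; move: Nhn hd Nh0; lra.
  have [dm em] := Bmul _ _ (conj di Ni) (conj dk Nkd).
  rewrite expgSr; split=> //; rewrite Nk -Nw phik (addrC e w) addrK in em.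
  have -> : (phi (k ^+ i * k)%g - e - i.+1%:R *: w =
    (phi (k ^+ i * k)%g - phi (k ^+ i)%g - w) + (phi (k ^+ i)%g - e - i%:R *: w))%R.
    by rewrite -natr1 scalerDl scale1r [RHS]addrACA subrKA -opprD [(w + _)%R]addrC.
  apply: le_trans (ler_normD _ _) _.
  by rewrite -natr1 mulrDl mul1r addrC lerD.
have [dkn ekn] := pow n (leqnn n).
have nw : (n%:R *: w = phi h - e)%R by rewrite scalerA divff ?scale1r // gt_eqF.
have nN : (n%:R * (4^-1 * `|w|) = N h / 4)%R.
  by rewrite Nw mulrCA [(n%:R * _)%R]mulrC divfK ?gt_eqF // mulrC.
rewrite nw nN in ekn.
have Nkn : (N (k ^+ n)%g < r)%R.
  rewrite /N -[X in (`|X| < _)%R](subrK (phi h - e)%R); apply: le_lt_trans (ler_normD _ _) _.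
  move: ekn Nh Nh0; rewrite -/(N h); move: (`|_ - _ - _|)%R => x; lra.
have Nhr : (N h < r)%R by move: Nh Nh0; lra.
have [dh' Nh'] := Br _ _ (conj dkn Nkn) (conj dh Nhr).
exists k, ((k ^+ n)^-1 * h); split=> //; first by rewrite mulVKg.
have [_] := Bmul _ _ (conj dkn (lt_le_trans Nkn rd)) (conj dh' Nh').
rewrite mulVKg; set z := (_^-1 * h) in Nh' *.
have : (N z <= `|phi h - phi (k ^+ n)%g - (phi z - e)| + `|phi (k ^+ n)%g - e - (phi h - e)|)%R.
  rewrite /N [X in (`|X| <= _)%R](_ : _ = - (phi h - phi (k ^+ n)%g - (phi z - e)) -
    (phi (k ^+ n)%g - e - (phi h - e)))%R; last first.
    rewrite (_ : phi (k ^+ n)%g - e - (phi h - e) = phi (k ^+ n)%g - phi h)%R.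
      by rewrite opprB (opprB (phi _)) addrK.
    by rewrite opprD opprK addrACA addNr addr0.
  by apply: le_trans (ler_normB _ _) _; rewrite normrN.
move: ekn Nh0; move: (`|_ - _ - _|)%R => x; move: (`|_ - _ - _|)%R => y.
move: (N z) (N h) => u v; lra.
Unshelve. all: by end_near.
Qed.

End SmallRoots.

Section Divisible.
Context (R : realType) (G : lieGroupType R).

(** The remaining factor is treated in the same way.  After [t] steps it is smaller by
    [2 ^ t]; modulo commutators, the [n]-th power of the product of the [t] small roots
    is the product of their powers. *)
Lemma near_infinitely_divisible : \forall h \near (1 : G), infinitely_divisible h.
Proof.
have [N [C [r [r0 N0 near_C basis root]]]] := @lie_local_norm R G.
apply: filterS (near_C r r0) => h [Ch Nh].
have approx t : forall U, nbhs 1 U -> exists2 n0, (0 < n0)%N & forall n, (n0 <= n)%N ->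
    exists k h', [/\ U k, C h', (N h' <= N h / 2 ^+ t)%R & h =[2] k ^+ n * h'].
  elim: t => [|t IHt] U U1.
    exists 1%N => // n _; exists 1, h; split => //; first exact: nbhs_singleton.
      by rewrite expr0 divr1.
    by rewrite expg1n mul1g.
  have [V V1 VU] := nbhs1_mul U1; have [n0 n00 Hn0] := IHt _ V1.
  have [s s0 sV] := basis _ V1.
  pose n1 := (Num.bound (r / s)).+1.
  exists (maxn n0 n1) => [|n]; first by rewrite leq_max n00.
  rewrite geq_max => /andP[/Hn0[k [h' [Vk Ch' Nh' e]]] n1n].
  have Nh'h : (N h' <= N h)%R.
    by apply: le_trans Nh' _; rewrite ler_pdivrMr ?exprn_gt0 // ler_peMr // exprn_ege1 // ler1n.
  have n_gt0 : (0 < n)%N by exact: leq_trans n1n.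
  have [k' [h'' [e' Ck' Nk' Ch'' Nh'']]] := root h' n Ch' (le_lt_trans Nh'h Nh) n_gt0.
  exists (k * k'), h''; split => //.
  - apply: VU => //; apply: sV => //; rewrite Nk' ltr_pdivrMr ?ltr0n //.
    rewrite (le_lt_trans Nh'h) // (lt_trans Nh) // mulrC -ltr_pdivrMr //.
    apply: (lt_le_trans (archi_boundP _)); first by rewrite divr_ge0 // ltW.
    by rewrite ler_nat ltnW.
  - apply: le_trans Nh'' _; rewrite exprSr invfM mulrA ler_pM2r ?invr_gt0 //.
  - by rewrite expgMn_cong2 -mulgA -e'.
move=> U U1; have [s s0 sU] := basis _ (filterI U1 (nbhs1_inv U1)).
have [t Ht] : exists t, (N h / 2 ^+ t < s)%R.
  exists (Num.bound (N h / s)); rewrite ltr_pdivrMr ?exprn_gt0 // mulrC -ltr_pdivrMr //.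
  apply: (lt_trans (archi_boundP _)); first by rewrite divr_ge0 // ltW.
  by rewrite -natrX ltr_nat ltn_expl.
have [n0 n00 Hn0] := approx t _ U1; exists n0 => n /Hn0[k [h' [Uk Ch' Nh' e]]].
have [_ Uh'] := sU _ Ch' (le_lt_trans Nh' Ht).
by exists k, h'^-1; split => //; rewrite e mulgK.
Qed.

(** An open subgroup is closed, its complement being a union of cosets. *)
Lemma open_subgroup_component (H : set G) :
  is_subgroup H -> nbhs 1 H -> identity_component G `<=` H.
Proof.
move=> [H1 HM HV] nH.
have oH : open H.
  rewrite openE => x Hx; apply: nbhs_mul1K; apply: filterS nH => u; exact: HM.
have cH : closed H.
  rewrite -[H]setCK; apply: open_closedC; rewrite openE => x nHx.
  apply: nbhs_mul1K; apply: filterS nH => u Hu Hxu; apply: nHx.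
  by rewrite -(mulgK u x); apply: HM => //; exact: HV.
have conn : connected (identity_component G) by exact: component_connected.
have C1 : identity_component G 1 by exact: connected_component_refl.
have <- : identity_component G `&` H = identity_component G.
  by apply: conn; [exists 1|exists H|exists H].
by move=> x [].
Qed.

Lemma component_divisible (h : G) : identity_component G h -> infinitely_divisible h.
Proof.
apply: open_subgroup_component; first exact: infinitely_divisible_subgroup.
exact: near_infinitely_divisible.
Qed.

End Divisible.

(** * Lifting from the homogeneous space *)

Local Open Scope quotient_scope.

Section CosetSpace.
Context (G : topologicalGroupType) (Gamma : groupClosed G).

Local Notation L := (lower_central G).
Local Notation Gam := [set` Gamma].
Local Notation pi := (\pi_(coset_space Gamma)).

Lemma Gamma_is_subgroup : is_subgroup Gam.
Proof.
split=> [|x y /= Gx Gy|x /= Gx]; first exact: gpred1.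
  exact: gpredM.
by rewrite gpredV.
Qed.

Lemma pi_eq g h : pi g = pi h <-> g^-1 * h \in Gamma.
Proof. by split=> [/eqmodP|e]; [|apply/eqmodP]. Qed.

Lemma pi_mul_Gamma g c : c \in Gamma -> pi (g * c) = pi g.
Proof. by move=> Gc; apply/pi_eq; rewrite invgM mulgVK gpredV. Qed.

Lemma nbhs_pi g V : nbhs (pi g) V -> \forall u \near 1, V (pi (g * u)).
Proof. by move=> Vg; apply: (@nbhs_mul1 _ (pi @^-1` V)); exact: (@pi_continuous _ _ g V Vg). Qed.

Lemma pi_nbhs g W : nbhs g W -> nbhs (pi g) (pi @` W).
Proof.
move=> nW; apply: (@filterS _ _ _ (pi @` W^°)).
  by apply: image_subset; exact: interior_subset.
apply: open_nbhs_nbhs; split; last by exists g => //; exact: nbhs_singleton (nbhs_interior nW).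
suff : open (pi @^-1` (pi @` W^°)) by [].
rewrite openE => x [w Ww /pi_eq Gwx].
have c : continuous (fun y : G => y * (w^-1 * x)^-1) by contg.
have := c x W^°; rewrite /= (_ : x * _ = w); last by word.
move=> /(_ (open_nbhs_nbhs (conj (@open_interior _ W) Ww))) H.
apply: (@filterS _ (nbhs x) _ _ _ _ H) => y Wy; exists (y * (w^-1 * x)^-1) => //.
by apply: pi_mul_Gamma; rewrite gpredV.
Qed.

(** The small factor is on the left, where right multiplication by the unbounded [c] does
    not conjugate it. *)
Lemma compact_cocompact U : compact [set: coset_space Gamma] -> nbhs 1 U ->
  exists s : seq G, forall x, exists b u c, [/\ b \in s, U u, Gam c & x = u * b * c].
Proof.
move=> /compact_near_coveringP cov U1.
(* the filter of large finite sets expresses the existence of a finite subcover *)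
pose F : set_system (seq G) := fun A =>
  exists s0 : seq G, forall s : seq G, {subset s0 <= s} -> A s.
have FF : Filter F.
  split=> [|A B [s HA] [t HB]|A B AB [s HA]]; first by exists [::].
    exists (s ++ t) => r sr; split.
      by apply: HA => x xs; apply: sr; rewrite mem_cat xs.
    by apply: HB => x xs; apply: sr; rewrite mem_cat xs orbT.
  by exists s => r sr; apply/AB/HA.
pose P (s : seq G) x := exists b u, [/\ b \in s, U u & x = pi (u * b)].
have [|s Hs] := @cov _ F P FF.
  move=> x _; exists (pi @` [set u * repr x | u in U], [set s | repr x \in s]).
    split; last by exists [:: repr x] => s /= ->//; rewrite inE.
    rewrite -{1}[x]reprK; apply: pi_nbhs.
    have c : continuous (fun y : G => y * (repr x)^-1) by contg.
    have := c (repr x) U; rewrite /= mulgV => /(_ U1) H.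
    by apply: (@filterS _ (nbhs (repr x)) _ _ _ _ H) => y Uy; exists (y * (repr x)^-1) => //; word.
  by move=> [_ s] [[_ [u Uu <-] <-] /= xs]; exists (repr x), u.
exists s => x; have [//|b [u [bs Uu /pi_eq e]]] := Hs s _ (pi x) I.
exists b, u, ((u * b)^-1 * x); split=> //; last by word.
by rewrite /= -gpredV invgM invgK.
Qed.

Variable tau : G.

Lemma iterz_translation (n : nat) g :
  iterz (translation Gamma tau) n (pi g) = pi (tau ^+ n * g).
Proof.
elim: n => [|n IHn] /=; first by rewrite expg0 mul1g.
by rewrite /= in IHn; rewrite IHn translate_pi expgS mulgA.
Qed.

(** Negative times become positive after adding a large return time. *)
Lemma iterz_pi (n : int) : exists m h,
  iterz (translation Gamma tau) n (pi 1) = pi h /\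
  forall q, (m <= q)%N -> exists r, tau ^+ q * h = tau ^+ r.
Proof.
case: n => m.
  exists 0%N, (tau ^+ m); rewrite iterz_translation mulg1; split=> // q _.
  by exists (q + m)%N; rewrite expgnDr.
exists m.+1, (tau ^- m.+1); split=> [|q mq]; last first.
  by exists (q - m.+1)%N; rewrite expgnFr.
elim: m => [|m IHm]; first by rewrite /= translate_pi mulg1 expg1.
have -> : iterz (translation Gamma tau) (Negz m.+1) (pi 1) =
  translate tau^-1 (iterz (translation Gamma tau) (Negz m) (pi 1)) by [].
by rewrite IHm translate_pi [tau ^+ m.+2]expgSr invgM.
Qed.

Lemma orbit_dense_lift (b : G) U : minimal (translation Gamma tau) ->
  (forall h V N, nbhs 1 V -> exists2 n, (N <= n)%N &
    exists c u, [/\ Gam c, V u & tau ^+ n * h * c = h * u]) ->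
  nbhs 1 U -> exists n c u, [/\ Gam c, U u & tau ^+ n * c = b * u].
Proof.
move=> mini return_to nU; pose O := pi @` [set b * v | v in U^°].
have nO : nbhs (pi b) O.
  apply: pi_nbhs; apply: nbhs_mul1K; apply: filterS (nbhs_interior nU) => u Uu.
  by exists u.
have [|z [Oz [n _ nz]]] := mini (pi 1) O^° _ (@open_interior _ O).
  by exists (pi b); exact: nbhs_singleton (nbhs_interior nO).
have [m [h [eh powh]]] := iterz_pi n.
have [_ [v Uv <-] ev] := interior_subset Oz.
have /pi_eq Gh : pi h = pi (b * v) by rewrite ev -nz eh.
set w := h^-1 * (b * v) in Gh.
have near_u : \forall u \near 1, U (v * w^-1 * u * w).
  apply: (nbhs_word (f := fun u => v * w^-1 * u * w)); first by contg.
  by word; exact: Uv.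
have [r /powh[r' er] [c [u [Gc Uu e]]]] := return_to h _ m near_u.
exists r', (c * w), (v * w^-1 * u * w).
split=> //; first by apply: gpredM.
by rewrite mulgA -er e /w; word.
Qed.

End CosetSpace.

(** * Independence *)

Section Stages.
Context (G : topologicalGroupType) (Gamma : set G) (tau : G) (J d : nat) (M : finType).

Local Notation L := (lower_central G).

Hypothesis nilpotent : L J = [set 1].
Hypothesis realize : forall v : M -> {set 'I_d} -> G,
  (forall l A, L d.+1 (v l A)) -> realizable Gamma tau J [set: 'I_d]%SET v.

(** The cubes are chosen one after the other, each by a perturbation of the points
    that respects the open conditions imposed by the previous cubes. *)
Lemma realize_cubes (a g : G) (U : set G) (f : M -> nat -> {set 'I_d} -> bool) k :
  L d.+1 g -> open U -> U 1 ->
  exists (q : nat -> 'I_d -> nat) (b : M -> G), (forall l, U (a^-1 * b l)) /\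
    forall i l A, (i < k)%N -> A != finset.set0 -> exists2 c, Gamma c &
      U ((a * g ^+ f l i A)^-1 * (tau ^+ (\sum_(j in A) q i j)%N * b l * c)).
Proof.
move=> Lg oU U1.
have nU x : U x -> nbhs x U by move=> Ux; exact: open_nbhs_nbhs.
(* the new cube starts at [b l] instead of [a], and [g ^+ t] conjugates the difference *)
have [W oW [W1 WU]] : exists2 W, open W & W 1 /\
    forall u, W u -> U u /\ forall t : bool, U ((g ^+ t)^-1 * u * g ^+ t).
  have near_W : \forall u \near (1 : G), U u /\ forall t : bool, U ((g ^+ t)^-1 * u * g ^+ t).
    apply: filterI; first exact: nU.
    apply: filter_forall => t.
    by have := nbhs1_conj (g ^+ t)^-1 (nU _ U1); rewrite invgK.
  exists ([set u | U u /\ forall t : bool, U ((g ^+ t)^-1 * u * g ^+ t)]^°).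
    exact: open_interior.
  by split; [exact: nbhs_singleton (nbhs_interior near_W)|move=> u /interior_subset].
suff : exists (q : nat -> 'I_d -> nat) (b : M -> G), (forall l, W (a^-1 * b l)) /\
    forall i l A, (i < k)%N -> A != finset.set0 -> exists2 c, Gamma c &
      U ((a * g ^+ f l i A)^-1 * (tau ^+ (\sum_(j in A) q i j)%N * b l * c)).
  move=> [q [b [Wb H]]]; exists q, b; split=> // l.
  by have [] := WU _ (Wb l).
elim: k => [|k [q [b [Wb H]]]].
  by exists (fun _ _ => 0%N), (fun=> a); split=> // l; rewrite mulVg.
have near_old : \forall u \near (1 : G), forall l (i : 'I_k) (A : {set 'I_d}), A != finset.set0 ->
    exists2 c, Gamma c &
      U ((a * g ^+ f l i A)^-1 * (tau ^+ (\sum_(j in A) q i j)%N * (b l * u) * c)).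
  apply: filter_forall => l; apply: filter_forall => i; apply: filter_forall => A.
  have [->|A0] := eqVneq A finset.set0; first by apply: nearW => u /eqP.
  have [c Gc Uc] := H i l A (ltn_ord i) A0.
  have : \forall u \near (1 : G),
      U ((a * g ^+ f l i A)^-1 * (tau ^+ (\sum_(j in A) q i j)%N * (b l * u) * c)).
    apply: (nbhs_word (f := fun u => (a * g ^+ f l i A)^-1 *
      (tau ^+ (\sum_(j in A) q i j)%N * (b l * u) * c))); first by contg.
    by rewrite mulg1; exact: nU.
  by apply: filterS => u Uu _; exists c.
have near_W : \forall u \near (1 : G), forall l, W (a^-1 * b l * u).
  apply: filter_forall => l.
  apply: (nbhs_word (f := fun u => a^-1 * b l * u)); first by contg.
  by rewrite mulg1; apply: open_nbhs_nbhs; split => //; exact: Wb.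
have near_new : \forall u \near (1 : G), forall l (t : bool),
    U ((g ^+ t)^-1 * (a^-1 * b l) * g ^+ t * u).
  apply: filter_forall => l; apply: filter_forall => t.
  apply: (nbhs_word (f := fun u => (g ^+ t)^-1 * (a^-1 * b l) * g ^+ t * u)); first by contg.
  by rewrite mulg1; apply: nU; have [_] := WU _ (Wb l); apply.
have Lv l A : L d.+1 (g ^+ f l k A).
  by case: (f l k A); [rewrite expg1|rewrite expg0; exact: lcs1].
have [p [b' [c [u [Hb Hu]]]]] := realize Lv b (filterI (filterI near_old near_W) near_new).
exists (fun i => if i == k then p else q i), b'; split=> [l|i l A].
  by have [[_ /(_ l)]] := Hb l; word.
rewrite ltnS leq_eqVlt => /predU1P[->|ik] A0.
  rewrite eqxx; have [Gc [_ Uu] /(congJ nilpotent) e] := Hu l A (finset.subsetT A) A0.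
  exists (c l A) => //; rewrite e.
  by have := Uu l (f l k A); word.
rewrite ltn_eqF //.
have [[/(_ l (Ordinal ik) A A0)[c' Gc' Uc'] _] _] := Hb l.
by exists c' => //; rewrite mulVKg in Uc'.
Qed.

End Stages.

(** In a small neighborhood of [g] there is at most one element of [Gamma], and it
    differs from [g]. *)
Lemma discrete_closed (G : topologicalGroupType) (Gamma : groupClosed G) (g : G) :
  hausdorff_space G -> [set` Gamma] `<=` isolated [set` Gamma] -> g \notin Gamma ->
  \forall u \near (1 : G), g * u \notin Gamma.
Proof.
move=> hG isol gG; have [_ [V V1 VG]] := isol 1 gpred1.
have [W W1 WV] : exists2 W, nbhs 1 W & forall u v, W u -> W v -> V (u^-1 * v).
  have /nbhs1_mul[W W1 WV] := V1.
  exists (W `&` (fun u => W u^-1)); first exact: filterI W1 (nbhs1_inv W1).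
  by move=> u v [_ Wu] [Wv _]; exact: WV.
have [[u0 [Wu0 Gu0]]|nu0] := pselect (exists u0, W u0 /\ g * u0 \in Gamma); last first.
  by apply: filterS W1 => u Wu; apply/negP => Gu; apply: nu0; exists u.
have u01 : 1 <> u0 by move=> e; move: gG; rewrite -(mulg1 g) e Gu0.
have : nbhs 1 (W `&` ~` [set u0]).
  apply: filterI => //; apply: open_nbhs_nbhs; split=> //.
  exact/closed_openC/accessible_closed_set1/hausdorff_accessible.
apply: filterS => u [Wu nu]; apply/negP => Gu; apply: nu.
have : (V `&` [set` Gamma]) (u0^-1 * u).
  split; first exact: WV.
  rewrite /= (_ : u0^-1 * u = (g * u0)^-1 * (g * u)); last by word.
  by apply: gpredM; rewrite ?gpredV.
by rewrite VG /= => e; rewrite -(mulVKg u0 u) e mulg1.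
Qed.

Lemma cube_sum_nat d (q : 'I_d -> nat) (e : {ffun 'I_d -> bool}) :
  cube_sum (fun j => Posz (q j)) e = Posz (\sum_(j in [set j | e j]%SET) q j)%N.
Proof.
rewrite /cube_sum (big_morph Posz PoszD (erefl _)) [RHS]big_mkcond /=.
apply: eq_bigr => j _; rewrite inE; case: (e j); first by rewrite mulr1n.
by rewrite mulr0n.
Qed.

Local Notation proj Gamma := (\pi_(coset_space Gamma)).

Theorem theorem4p5 (R : realType) (G : lieGroupType R) (Gamma : groupClosed G)
    (tau : G) (d : nat) :
  nilpotent_group G ->
  [set` Gamma] `<=` isolated [set` Gamma] ->
  compact [set: coset_space Gamma] ->
  minimal (translation Gamma tau) ->
  generated (identity_component G `|` [set tau]) = [set: G] ->
  (0 < d)%N ->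
  forall (x : coset_space Gamma) (g : G),
    lower_central G d.+1 g -> x <> translate g x ->
    IN_pair (translation Gamma tau) d x (translate g x).
Proof.
move=> [J nil] isol comp mini gen d0 x g Lg xgx k U0 U1 k0 nU0 nU1.
have GS := Gamma_is_subgroup Gamma.
have cocomp U := @compact_cocompact G Gamma U comp.
have rec (M : finType) : recurrent [set` Gamma] tau M J.
  exact: recurrent_all GS cocomp M J.
have return1 (b : G) U N : nbhs 1 U -> exists2 n, (N <= n)%N &
    exists c u, [/\ [set` Gamma] c, U u & tau ^+ n * b * c = b * u].
  move=> nU; have [n Nn /(_ tt)[c [u [Gc Uu /(congJ nil) e]]]] := rec unit (fun=> b) U N nU.
  by exists n => //; exists c, u.
have return_to_Gamma (U : set G) N : nbhs 1 U -> exists2 n, (N <= n)%N &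
    exists c u, [/\ [set` Gamma] c, U u & tau ^+ n * c = u].
  move=> /(return1 1 U N)[n Nn [c [u [Gc Uu e]]]]; exists n => //; exists c, u.
  by split=> //; move: e; rewrite mulg1 mul1g.
have orbit_dense (b : G) (U : set G) : nbhs 1 U ->
    exists n c u, [/\ [set` Gamma] c, U u & tau ^+ n * c = b * u].
  exact: orbit_dense_lift mini return1.
have div_gen (H : set G) : is_subgroup H -> (forall h, infinitely_divisible h -> H h) ->
    H tau -> H = [set: G].
  move=> sH dH Ht; apply/seteqP; split=> // y _.
  have : generated (identity_component G `|` [set tau]) y by rewrite gen.
  apply: generated_sub => // z [/component_divisible|->//]; exact: dH.
(* one point for each assignment of a side to each vertex of each cube *)
pose M := {ffun 'I_k * {set 'I_d} -> bool}.
have realize (v : M -> {set 'I_d} -> G) : (forall l A, lower_central G d.+1 (v l A)) ->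
    realizable [set` Gamma] tau J [set: 'I_d]%SET v.
  move=> Lv; apply: (@realizable_patterns G [set` Gamma] tau _ _ J nil GS
    (rec M) return_to_Gamma orbit_dense div_gen _ d.+1) => //.
  by rewrite cardsT card_ord.
pose a := repr x; pose g' := a^-1 * g * a.
have xa : x = proj Gamma a by rewrite reprK.
have gxa : translate g x = proj Gamma (a * g').
  by rewrite xa translate_pi; congr (proj Gamma _); rewrite /g'; word.
have Lg' : lower_central G d.+1 g'.
  by have := lcsJ a^-1 Lg; rewrite invgK.
have ng' : g' \notin Gamma.
  apply/negP => Gg'; apply: xgx; rewrite gxa {1}xa; apply/pi_eq.
  by rewrite mulKg.
have [U [oU U1' UU0 UU1 Udisj]] : exists U : set G, [/\ open U, U 1,
    forall u, U u -> U0 (proj Gamma (a * u)),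
    forall u, U u -> U1 (proj Gamma (a * g' * u))
    & forall u v, U u -> U v -> proj Gamma (a * u) <> proj Gamma (a * g' * v)].
  have near0 : \forall u \near (1 : G), U0 (proj Gamma (a * u)).
    by apply: nbhs_pi; rewrite -xa.
  have near1 : \forall u \near (1 : G), U1 (proj Gamma (a * g' * u)).
    by apply: nbhs_pi; rewrite -gxa.
  have [V V1 HV] : exists2 V, nbhs 1 V & forall u v, V u -> V v -> u^-1 * g' * v \notin Gamma.
    have nG : nbhs g' (fun y => y \notin Gamma).
      by apply: nbhs_mul1K; exact: discrete_closed (@lie_hausdorff R G) isol ng'.
    have c : continuous (fun p : G * G => p.1^-1 * g' * p.2).
      have c1 : continuous (fun p : G * G => p.1) by move=> p; exact: cvg_fst.
      have c2 : continuous (fun p : G * G => p.2) by move=> p; exact: cvg_snd.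
      by repeat first [exact: c1 | exact: c2 | exact: cstg_cont
        | apply: mulg_cont | apply: invg_cont].
    have := c (1, 1) (fun y => y \notin Gamma); rewrite /= invg1 mul1g mulg1 => /(_ nG).
    move=> [[A B] /= [A1 B1] AB]; exists (A `&` B); first exact: filterI.
    by move=> u v [Au _] [_ Bv]; exact: (AB (u, v)).
  have nU := filterI (filterI near0 near1) V1.
  exists (([set u | U0 (proj Gamma (a * u))] `&` [set u | U1 (proj Gamma (a * g' * u))]
    `&` V)^°).
  split=> [||u|u|u v]; first exact: open_interior.
  - exact: nU.
  - by move=> /interior_subset[[]].
  - by move=> /interior_subset[[]].
  - move=> /interior_subset[_ Vu] /interior_subset[_ Vv] /pi_eq.
    rewrite (_ : _^-1 * _ = u^-1 * g' * v); last by word.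
    by apply/negP; exact: HV.
case: k k0 @M realize => // k _ M realize.
pose f (s : M) i A := s (inord i : 'I_k.+1, A).
have [q [b [Ub Hq]]] := realize_cubes nil realize a f k.+1 Lg' oU U1'.
pose p (i : 'I_k.+1) j := Posz (q i j).
pose supp (e : {ffun 'I_d -> bool}) := [set j | e j]%SET.
have supp_inj e e' : supp e = supp e' -> e = e'.
  by move/setP => ee'; apply/ffunP => j; have := ee' j; rewrite !inE.
have supp0 e : e != [ffun=> false] -> supp e != finset.set0.
  apply: contra => /eqP se; apply/eqP/supp_inj; rewrite se.
  by apply/setP => j; rewrite !inE ffunE.
have visit (s : M) i e : e != [ffun=> false] -> exists2 u, U u &
    iterz (translation Gamma tau) (cube_sum (p i) e) (proj Gamma (b s)) =
    proj Gamma (a * g' ^+ s (i, supp e) * u).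
  move=> /supp0 e0; have [c Gc Uc] := Hq i s (supp e) (ltn_ord i) e0.
  rewrite /f inord_val in Uc; exists ((a * g' ^+ s (i, supp e))^-1 *
    (tau ^+ (\sum_(j in supp e) q i j)%N * b s * c)) => //.
  rewrite cube_sum_nat iterz_translation mulVKg.
  by symmetry; exact: pi_mul_Gamma.
have separate (s : M) i i' e e' : e != [ffun=> false] -> e' != [ffun=> false] ->
    cube_sum (p i) e = cube_sum (p i') e' -> s (i, supp e) -> s (i', supp e').
  move=> e0 e'0 ee' se; have [u Uu eu] := visit s i e e0.
  have [u' Uu' eu'] := visit s i' e' e'0; apply/negPn/negP => /negPf se'.
  by move: eu eu'; rewrite ee' => ->; rewrite se se' expg1 mulg1 => /esym; exact: Udisj.
exists p.
  split=> [i e e0 ei0|i i' e e' e0 e'0 ee'].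
    pose s : M := [ffun=> true].
    have [u Uu] := visit s i e e0; rewrite ei0 ffunE /= => eu.
    have Uv := Ub s; apply: (Udisj _ u Uv Uu); rewrite mulVKg eu expg1.
    by [].
  pose s : M := [ffun z => z == (i, supp e)].
  have := separate s i i' e e' e0 e'0 ee'; rewrite !ffunE eqxx => /(_ isT)/eqP[-> /supp_inj ->].
  by [].
move=> I s _ _ Icubes.
pose s' : M := [ffun z : 'I_k.+1 * {set 'I_d} => s (cube_sum (p z.1) [ffun j => j \in z.2])].
exists (proj Gamma (b s')) => n In; have [[i [e ne]] n0] := Icubes n In.
have e0 : e != [ffun=> false].
  apply: contra_not_neq n0 => e0; rewrite ne /cube_sum big1 //= => j _.
  by rewrite e0 ffunE mulr0n.
have [u Uu] := visit s' i e e0; rewrite /preimage /= ne => ->.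
have -> : s' (i, supp e) = s (cube_sum (p i) e).
  by rewrite ffunE /=; congr (s (cube_sum _ _)); apply/ffunP => j; rewrite ffunE inE.
by case: (s _); [rewrite expg1; exact: UU1|rewrite expg0 mulg1; exact: UU0].
Qed.
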